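(* Let $b\ge 2$ and $m,s\ge 1$ be integers, let $\mathcal{P}$ be a digital net over $\mathbb{Z}_b$ in $G^s$ (with generating matrices $C_1,\ldots,C_s\in\mathbb{Z}_b^{\mathbb{N}\times m}$), and let $\mathcal{P}^{\perp}$ be its dual net. Let $H$ be a reproducing kernel Hilbert space of real-valued functions on $[0,1]^s$ with a continuous reproducing kernel $K:[0,1]^s\times[0,1]^s\to\mathbb{R}$ which satisfies $\int_{[0,1]^s}\sqrt{K(\boldsymbol{x},\boldsymbol{x})}\,d\boldsymbol{x}<\infty$ and $\sum_{\boldsymbol{k},\boldsymbol{l}\in\mathbb{N}_0^s}|\hat K(\boldsymbol{k},\boldsymbol{l})|<\infty$. Then $$\left(e^{\mathrm{wor}}(H;\pi(\mathcal{P}_{b\text{-}\mathrm{ant}}))\right)^2=\sum_{\substack{\boldsymbol{k},\boldsymbol{l}\in\mathcal{P}^{\perp}\setminus\{\boldsymbol{0}\}\\ \delta(\boldsymbol{k})=\delta(\boldsymbol{l})=0}}\hat K(\boldsymbol{k},\boldsymbol{l}),$$ where $\mathcal{P}_{b\text{-}\mathrm{ant}}$ is the $b$-adic antithetic sampling of $\mathcal{P}$.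
   Context: Notation: $\mathbb{N}=\{1,2,\ldots\}$, $\mathbb{N}_0=\mathbb{N}\cup\{0\}$, $\omega_b=\exp(2\pi\sqrt{-1}/b)$. $\mathbb{Z}_b$ is the ring of integers modulo $b$, identified with $\{0,\ldots,b-1\}$. $G=\prod_{i\ge1}\mathbb{Z}_b$ is the infinite direct product group; $\oplus$ denotes componentwise addition modulo $b$ in $\mathbb{Z}_b$, $G$, $G^s$ and in $\mathbb{Z}_b^m$. Projection: $\pi:G\to[0,1]$, $\pi(\zeta_1,\zeta_2,\ldots)=\sum_{i\ge1}\zeta_i b^{-i}$ (with each $\zeta_i$ regarded as an integer in $\{0,\ldots,b-1\}$), applied componentwise to $G^s$. All point sets are finite and counted with multiplicity (i.e. are indexed families/multisets). Digital net: given $C_1,\ldots,C_s\in\mathbb{Z}_b^{\mathbb{N}\times m}$ (infinitely many rows, $m$ columns, no finiteness condition on the columns), for $0\le h<b^m$ with $h=\eta_0+\eta_1b+\cdots+\eta_{m-1}b^{m-1}$, $\eta_i\in\{0,\ldots,b-1\}$, let $\boldsymbol{z}_h=(z_{h,1},\ldots,z_{h,s})\in G^s$ with $z_{h,j}^{\top}=C_j(\eta_0,\ldots,\eta_{m-1})^{\top}$ (computed over $\mathbb{Z}_b$). The digital net over $\mathbb{Z}_b$ in $G^s$ with generating matrices $C_1,\ldots,C_s$ is $\mathcal{P}=\{\boldsymbol{z}_0,\ldots,\boldsymbol{z}_{b^m-1}\}$ (so $|\mathcal{P}|=b^m$). Dual net: for $k\in\mathbb{N}_0$ with finite $b$-adic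 expansion $k=\kappa_0+\kappa_1b+\cdots$, write $\vec{k}=(\kappa_0,\kappa_1,\ldots)$. Then $\mathcal{P}^{\perp}=\{\boldsymbol{k}=(k_1,\ldots,k_s)\in\mathbb{N}_0^s:\vec{k}_1C_1\oplus\cdots\oplus\vec{k}_sC_s=(0,\ldots,0)\in\mathbb{Z}_b^m\}$. $b$-adic antithetic sampling: for $l\in\mathbb{Z}_b$ let $e_l=(l,l,\ldots)\in G$ and $\boldsymbol{e}_l=(e_l,\ldots,e_l)\in G^s$. Then $\mathcal{P}_{b\text{-}\mathrm{ant}}=\bigcup_{l\in\mathbb{Z}_b}\{\boldsymbol{z}\oplus\boldsymbol{e}_l:\boldsymbol{z}\in\mathcal{P}\}$, with multiplicity, so $|\mathcal{P}_{b\text{-}\mathrm{ant}}|=b|\mathcal{P}|$. Sum of digits modulo $b$: $\delta(k)=\sum_{i\ge0}\kappa_i \bmod b$ for $k=\sum_i\kappa_ib^i\in\mathbb{N}_0$, and $\delta(\boldsymbol{k})=\sum_{j=1}^s\delta(k_j)\bmod b$ for $\boldsymbol{k}\in\mathbb{N}_0^s$. Walsh functions: each $x\in[0,1]$ is written $x=\xi_1/b+\xi_2/b^2+\cdots$ with $\xi_i\in\{0,\ldots,b-1\}$, infinitely many $\xi_i\ne b-1$ if $x\in[0,1)$, and all $\xi_i=b-1$ if $x=1$. For $k=\kappa_0+\kappa_1b+\cdots\in\mathbb{N}_0$, $\mathrm{wal}_k(x)=\omega_b^{\kappa_0\xi_1+\kappa_1\xi_2+\cdots}$; for $\boldsymbol{k}\in\mathbb{N}_0^s$,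 $\mathrm{wal}_{\boldsymbol{k}}(\boldsymbol{x})=\prod_{j=1}^s\mathrm{wal}_{k_j}(x_j)$. Walsh coefficients of the kernel: $\hat K(\boldsymbol{k},\boldsymbol{l})=\int_{[0,1]^{2s}}K(\boldsymbol{x},\boldsymbol{y})\overline{\mathrm{wal}_{\boldsymbol{k}}(\boldsymbol{x})}\,\mathrm{wal}_{\boldsymbol{l}}(\boldsymbol{y})\,d\boldsymbol{x}\,d\boldsymbol{y}$. Worst-case error: with $I(f)=\int_{[0,1]^s}f(\boldsymbol{x})\,d\boldsymbol{x}$ and $I(f;P)=\frac1{|P|}\sum_{\boldsymbol{x}\in P}f(\boldsymbol{x})$ (with multiplicity), $e^{\mathrm{wor}}(H;P)=\sup_{f\in H,\ \|f\|_H\le1}|I(f;P)-I(f)|$. *)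

(* Defs.v *)
From HB Require Import structures.
From mathcomp Require Import all_boot all_order all_algebra.
From mathcomp Require Import ring complex.
From mathcomp Require Import all_classical all_reals all_analysis.

Set Implicit Arguments.
Unset Strict Implicit.
Unset Printing Implicit Defensive.

Import Order.TTheory GRing.Theory Num.Theory.
Import numFieldNormedType.Exports.

Local Open Scope classical_set_scope.
Local Open Scope ring_scope.

(** Points of [R^s] are tuples [x : s.-tuple R], with the library's product
    sigma-algebra; the topology below is the product topology. *)

HB.instance Definition _ (n : nat) (T : topologicalType) :=
  Topological.copy (n.-tuple T)
    (initial_topology (fun x : n.-tuple T => \row_(i < n) tnth x i)).

Lemma continuous_tnth (R : realType) n (i : 'I_n) :
  continuous (fun x : n.-tuple R => tnth x i).
Proof.
move=> x; rewrite (_ : (fun y : n.-tuple R => tnth y i) =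
  (fun M : 'rV[R]_n => M ord0 i) \o (fun y : n.-tuple R => \row_(j < n) tnth y j)).
  apply: continuous_comp; first exact: initial_continuous.
  exact: coord_continuous.
by apply/funext => y; rewrite /= mxE.
Qed.

Section lebesgue_tuple.
Context {R : realType}.
Local Notation mR := (measurableTypeR R).

Definition cons_pair n (p : mR * n.-tuple mR) : n.+1.-tuple mR :=
  [tuple of p.1 :: p.2].

Lemma measurable_cons_pair n : measurable_fun setT (@cons_pair n).
Proof. exact: (measurable_cons measurable_fst measurable_snd). Qed.

Fixpoint lebesgue_tuple (n : nat) : set (n.-tuple mR) -> \bar R :=
  if n is n'.+1 then
    pushforward (lebesgue_measure \x^ @lebesgue_tuple n')%E (@cons_pair n')
  else dirac [tuple].
Arguments lebesgue_tuple n _ : clear implicits.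

Lemma lebesgue_tuple_measure n :
  exists mu : {measure set (n.-tuple mR) -> \bar R}, lebesgue_tuple n = mu.
Proof.
elim: n => [|n [mu /= ->]]; first by exists (dirac [tuple]).
have mc := @measurable_cons_pair n.
pose nu : {measure set _ -> \bar R} := (lebesgue_measure \x^ mu)%E.
exists (measure_function_pushforward__canonical__measure_function_Measure nu mc).
by [].
Qed.

Let lebesgue_tuple0 n : lebesgue_tuple n set0 = 0%E.
Proof. by have [mu ->] := lebesgue_tuple_measure n; exact: measure0. Qed.

Let lebesgue_tuple_ge0 n A : (0 <= lebesgue_tuple n A)%E.
Proof. by have [mu ->] := lebesgue_tuple_measure n; exact: measure_ge0. Qed.

Let lebesgue_tuple_sigma_additive n : semi_sigma_additive (lebesgue_tuple n).
Proof.
have [mu ->] := lebesgue_tuple_measure n.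
exact: measure_semi_sigma_additive.
Qed.

HB.instance Definition _ n := isMeasure.Build _ _ _ (lebesgue_tuple n)
  (lebesgue_tuple0 n) (@lebesgue_tuple_ge0 n)
  (@lebesgue_tuple_sigma_additive n).

Lemma measurable_tuple_box n (A : 'I_n -> set mR) :
  (forall i, measurable (A i)) ->
  measurable [set x : n.-tuple mR | forall i, A i (tnth x i)].
Proof.
move=> mA.
rewrite (_ : mkset _ = \bigcap_(i in setT) ((@tnth n mR)^~ i @^-1` A i)).
  apply: fin_bigcap_measurable => // i _; rewrite -[X in measurable X]setTI.
  exact: (measurable_tnth i).
by apply/seteqP; split => x /= h i; [move=> _; exact: h|exact: (h i)].
Qed.

Lemma lebesgue_tuple_box n (A : 'I_n -> set mR) :
  (forall i, measurable (A i)) ->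
  lebesgue_tuple n [set x | forall i, A i (tnth x i)] =
  (\prod_(i < n) lebesgue_measure (A i))%E.
Proof.
elim: n A => [A _|n IHn A mA] /=.
  by rewrite big_ord0 /dirac indicE mem_set// => -[].
rewrite big_ord_recl -IHn; last by move=> i; exact: mA.
rewrite /pushforward -product_measure2E//; last first.
  by apply: (@measurable_tuple_box n (fun i => A (lift ord0 i))) => i; exact: mA.
congr (_ _); apply/seteqP; split => [[a t] /= h|[a t] /= [Aa h] i].
  split; first exact: (h ord0).
  by move=> i; have := h (lift ord0 i); rewrite tnthS.
by case: (unliftP ord0 i) => [j ->|->//]; rewrite tnthS.
Qed.

Let lebesgue_tuple_sigma_finite n : sigma_finite setT (lebesgue_tuple n).
Proof.
exists (fun k : nat => [set x | forall i, tnth x i \in `[- k%:R, k%:R : R]]).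
  apply/esym; rewrite -subTset => x _.
  have [k xk] : exists k : nat, forall i, `|tnth x i : R| <= k%:R.
    exists (Num.truncn (\sum_i `|tnth x i : R|)).+1 => i.
    rewrite (@le_trans _ _ (\sum_i `|tnth x i : R|))//.
      by rewrite (bigD1 i)//= lerDl sumr_ge0.
    by rewrite ltW// truncnS_gt.
  by exists k => // i; rewrite in_itv/= -ler_norml.
move=> k; split.
  by apply: (@measurable_tuple_box n (fun=> [set` `[- k%:R, k%:R]])) => i.
rewrite (@lebesgue_tuple_box n (fun=> [set` `[- k%:R, k%:R]]))//=.
rewrite ltey_eq; apply/orP; left.
elim/big_ind: _ => [//|x y|i _]; first exact: fin_numM.
by rewrite lebesgue_measure_itv/=; case: ifPn.
Qed.

HB.instance Definition _ n := @Measure_isSigmaFinite.Build _ _ _ (lebesgue_tuple n)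
  (@lebesgue_tuple_sigma_finite n).
End lebesgue_tuple.
Arguments lebesgue_tuple {R} n _.

Definition unit_cube {R : realType} (s : nat) : set (s.-tuple R) :=
  [set x | forall j, tnth x j \in `[0, 1]].

Arguments unit_cube {R} s _.

Definition complex_integral {d} {T : measurableType d} {R : realType}
    (mu : {measure set T -> \bar R}) (D : set T) (f : T -> R[i]) : R[i] :=
  ((\int[mu]_(x in D) complex.Re (f x)) +i*
   (\int[mu]_(x in D) complex.Im (f x)))%C.

(** [S] is the sum of the family [a] over [A], in the sense of the net of
    finite partial sums (hence independent of any enumeration of [A]). *)
Definition has_complex_sum {R : realType} {T : choiceType} (A : set T)
    (a : T -> R[i]) (S : R[i]) : Prop :=
  forall eps : R, 0 < eps ->
    exists2 F0, fsets A F0 &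
      forall F, fsets A F -> F0 `<=` F ->
        Normc.normc (\sum_(k \in F) a k - S) < eps.

(** [digit b k i] is kappa_i; it vanishes for [k <= i] when [1 < b], so sums
    over all the digits of [k] are written as sums over [i < k]. *)
Definition digit (b k i : nat) : nat := ((k %/ b ^ i) %% b)%N.

Definition digit_sum (b k : nat) : nat := ((\sum_(i < k) digit b k i) %% b)%N.

Definition mdigit_sum (b s : nat) (k : s.-tuple nat) : nat :=
  ((\sum_(j < s) digit_sum b (tnth k j)) %% b)%N.

(** [rdigit b x i] is xi_(i+1); [cvg_rdigit] and [rdigit_inf_neq] below
    show that this is the prescribed expansion of [x]. *)
Definition rdigit {R : realType} (b : nat) (x : R) (i : nat) : nat :=
  if x == 1 then b.-1 else (Num.truncn (x * b%:R ^+ i.+1)%R %% b)%N.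

Section rdigit.
Context {R : realType} (b : nat) (b1 : (1 < b)%N).
Let b0 : 0 < b%:R :> R. Proof. by rewrite ltr0n ltnW. Qed.

Lemma truncn_divn (y : R) : 0 <= y -> (Num.truncn (y * b%:R) %/ b)%N = Num.truncn y.
Proof.
move=> y0; have := truncn_itv y0; set t := Num.truncn y => /andP[ty yt].
have yb0 : 0 <= y * b%:R by rewrite mulr_ge0// ltW.
have := truncn_itv yb0; set u := Num.truncn _ => /andP[uy yu].
apply/eqP; rewrite eqn_leq -ltnS ltn_divLR ?(ltnW b1)// leq_divRL ?(ltnW b1)//.
rewrite -(ltr_nat R) -ltnS -(ltr_nat R) !natrM.
rewrite (le_lt_trans uy) ?ltr_pM2r//=.
by rewrite (le_lt_trans _ yu)// ler_pM2r.
Qed.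

Lemma rdigit_sum (x : R) n : 0 <= x -> x < 1 ->
  \sum_(i < n) ((rdigit b x i)%:R * b%:R ^- i.+1 : R) =
  (Num.truncn (x * b%:R ^+ n))%:R * b%:R ^- n.
Proof.
move=> x0 x1; elim: n => [|n IHn].
  rewrite big_ord0 expr0 mulr1 (_ : Num.truncn x = 0%N) ?mul0r//.
  by have /andP[h _] := truncn_itv x0; apply/eqP; rewrite -leqn0 -ltnS -(ltr_nat R) (le_lt_trans h).
rewrite big_ord_recr/= IHn /rdigit (lt_eqF x1).
set u := Num.truncn (x * b%:R ^+ n.+1).
have <- : (u %/ b)%N = Num.truncn (x * b%:R ^+ n).
  rewrite /u exprSr mulrA truncn_divn// mulr_ge0// exprn_ge0//.
rewrite {3}(divn_eq u b) natrD natrM mulrDl; congr (_ + _).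
by rewrite exprS invfM -mulrA mulrA mulrA mulfK// gt_eqF.
Qed.

Lemma cvg_expVn : (fun n => b%:R ^- n : R) @ \oo --> (0:R).
Proof.
under eq_fun do rewrite -exprVn.
apply: cvg_expr; rewrite ger0_norm ?invr_ge0 ?ltW//.
by rewrite invf_lt1 ?ltr1n.
Qed.

Lemma cvg_rdigit (x : R) : 0 <= x <= 1 ->
  (fun n => \sum_(i < n) ((rdigit b x i)%:R * b%:R ^- i.+1 : R)) @ \oo --> x.
Proof.
move=> /andP[x0 x1].
have cvgx : (fun n => x - b%:R ^- n) @ \oo --> x.
  by rewrite -[X in _ --> X]subr0; apply: cvgB; [exact: cvg_cst|exact: cvg_expVn].
have [x1'|x1'] := eqVneq x 1.
  rewrite x1' in cvgx *; rewrite (_ : (fun _ => _) = (fun n => 1 - b%:R ^- n))//.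
  apply/funext; elim => [|n IHn]; first by rewrite big_ord0 expr0 invr1 subrr.
  rewrite big_ord_recr /= IHn /rdigit eqxx -subn1 natrB ?(ltnW b1)//.
  have := b0 => /gt_eqF/negbT; rewrite exprS => bn0; field.
  by rewrite bn0 expf_neq0.
apply: (@squeeze_cvgr _ _ _ _ (fun n => x - b%:R ^- n) (fun=> x)) => //; last exact: cvg_cst.
near=> n; have bn : 0 < b%:R ^+ n :> R by rewrite exprn_gt0.
have xl : x < 1 by rewrite lt_neqAle x1'.
rewrite rdigit_sum//.
have xb : 0 <= x * b%:R ^+ n by rewrite mulr_ge0// ltW.
have /andP[h1 h2] := truncn_itv xb.
rewrite ler_pdivlMr// ler_pdivrMr// h1 andbT mulrBl mulVf ?gt_eqF//.
by rewrite lerBlDr natr1 ltW.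
Unshelve. all: by end_near. Qed.

Lemma rdigit_inf_neq (x : R) : 0 <= x < 1 ->
  forall n, exists2 i, (n <= i)%N & rdigit b x i != b.-1.
Proof.
move=> /andP[x0 x1] n; apply: contrapT => h.
have E i : (n <= i)%N -> rdigit b x i = b.-1.
  by move=> ni; apply/eqP/negP => /negP h'; apply: h; exists i.
have S k : \sum_(i < n + k) ((rdigit b x i)%:R * b%:R ^- i.+1 : R) =
    \sum_(i < n) ((rdigit b x i)%:R * b%:R ^- i.+1 : R) +
    (b%:R ^- n - b%:R ^- (n + k)).
  elim: k => [|k IHk]; first by rewrite addn0 subrr addr0.
  rewrite addnS big_ord_recr /= IHk E ?leq_addr// -subn1 natrB ?(ltnW b1)//.
  have := b0 => /gt_eqF/negbT; rewrite exprS => bn0; field.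
  by rewrite bn0 !expf_neq0.
have xb : 0 <= x * b%:R ^+ n by rewrite mulr_ge0// exprn_ge0.
have /andP[_] := truncn_itv xb; rewrite -ltr_pdivlMr ?exprn_gt0//.
rewrite -natr1 mulrDl mul1r -rdigit_sum//.
set y := (X in x < X) => xy.
have [k kxy] : exists k, b%:R ^- k < y - x.
  have /cvgr_lt : (fun n => b%:R ^- n : R) @ \oo --> (0:R) by exact: cvg_expVn.
  move=> /(_ (y - x)); rewrite subr_gt0 => /(_ xy) [k _ /(_ k (leqnn k)) ?].
  by exists k.
have : \sum_(i < n + k) ((rdigit b x i)%:R * b%:R ^- i.+1 : R) <= x.
  rewrite rdigit_sum// ler_pdivrMr ?exprn_gt0// truncn_le//.
  by rewrite mulr_ge0// exprn_ge0.
rewrite S addrA -/y lerBlDr -lerBlDl.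
apply/negP; rewrite -ltNge.
apply: le_lt_trans kxy.
by rewrite lef_pV2 ?posrE ?exprn_gt0// ler_weXn2l ?leq_addl// ler1n ltnW.
Qed.
End rdigit.

Definition omega {R : realType} (b : nat) : R[i] :=
  (cos (2 * pi / b%:R) +i* sin (2 * pi / b%:R))%C.

Definition wal {R : realType} (b k : nat) (x : R) : R[i] :=
  omega b ^+ \sum_(i < k) (digit b k i * rdigit b x i)%N.

Definition mwal {R : realType} (b s : nat) (k : s.-tuple nat)
    (x : s.-tuple R) : R[i] :=
  \prod_(j < s) wal b (tnth k j) (tnth x j).

Definition walsh_coef {R : realType} (b s : nat)
    (K : s.-tuple R -> s.-tuple R -> R) (k l : s.-tuple nat) : R[i] :=
  complex_integral (@lebesgue_tuple R s \x @lebesgue_tuple R s)%E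
    (unit_cube s `*` unit_cube s)
    (fun p => (K p.1 p.2)%:C%C * (mwal b k p.1)^*%C * mwal b l p.2).

(** An element of [G] is a sequence [z : nat -> 'Z_b], [z i] being
    the coordinate of index [i + 1]; an element of [G^s] is an ['I_s]-indexed
    family of those, and a point set is a family indexed by a finite type.
    ['Z_b] is the ring of integers modulo [b] only when [1 < b]. *)

(** [C j i] is row [i + 1] of the generating matrix of index [j]. *)
Definition digital_net (b m s : nat) (C : 'I_s -> nat -> 'rV['Z_b]_m)
    (h : 'I_(b ^ m)) : 'I_s -> nat -> 'Z_b :=
  fun j i => \sum_(c < m) C j i ord0 c * (digit b h c)%:R.

Definition dual_net (b m s : nat) (C : 'I_s -> nat -> 'rV['Z_b]_m) :
    set (s.-tuple nat) :=
  [set k | \sum_(j < s) \sum_(i < tnth k j)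
             (digit b (tnth k j) i)%:R *: C j i = 0].

Definition antithetic (b s : nat) (I : Type) (P : I -> 'I_s -> nat -> 'Z_b)
    (p : 'Z_b * I) : 'I_s -> nat -> 'Z_b :=
  fun j i => P p.2 j i + p.1.

Definition badic_proj {R : realType} (b : nat) (z : nat -> 'Z_b) : R :=
  limn (fun n => \sum_(i < n) ((z i : nat)%:R * b%:R ^- i.+1 : R)).

Definition badic_mproj {R : realType} (b s : nat) (z : 'I_s -> nat -> 'Z_b) :
    s.-tuple R :=
  [tuple badic_proj (z j) | j < s].

(** [H] is a Hilbert space: a complete normed space whose norm comes from the
    inner product [ip]. [ev] identifies it with a space of real functions on
    [D]; the values of [ev f] and [K] outside [D] are irrelevant. *)
Record is_rkhs {R : realType} {T : Type} (D : set T)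
    (H : completeNormedModType R) (ip : {dot H for idfun})
    (ev : {linear H -> (T -> R)}) (K : T -> T -> R) : Prop := IsRKHS {
  rkhs_norm : forall f : H, ip f f = `|f| ^+ 2 ;
  rkhs_ext : forall f g : H, (forall x, D x -> ev f x = ev g x) -> f = g ;
  rkhs_kernel : forall x, D x ->
    exists2 kx : H, (forall y, D y -> ev kx y = K y x) &
      forall f : H, ev f x = ip f kx
}.

Definition cube_integral {R : realType} (s : nat) (f : s.-tuple R -> R) : R :=
  \int[@lebesgue_tuple R s]_(x in unit_cube s) f x.

Definition sample_mean {R : realType} (s : nat) (I : finType)
    (P : I -> s.-tuple R) (f : s.-tuple R -> R) : R :=
  #|I|%:R^-1 * \sum_(i : I) f (P i).

Definition worst_case_error {R : realType} (s : nat)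
    (H : completeNormedModType R) (ev : {linear H -> (s.-tuple R -> R)})
    (I : finType) (P : I -> s.-tuple R) : \bar R :=
  ereal_sup [set `|sample_mean P (ev f) - cube_integral (ev f)|%:E
            | f in [set f : H | `|f| <= 1]].

(* Main.v *)
Require Import Defs.
From mathcomp Require Import all_boot all_order all_algebra.
From mathcomp Require Import complex.
From mathcomp Require Import all_classical all_reals all_analysis.
From mathcomp Require Import measurable_realfun ring lra zify.
Import Order.TTheory GRing.Theory Num.Theory.
Import numFieldNormedType.Exports.
Local Open Scope classical_set_scope.
Local Open Scope ring_scope.

Set Implicit Arguments.
Unset Strict Implicit.
Unset Printing Implicit Defensive.

(** Cut the unit cube into the [b^(n s)] b-adic cells of level [n], indexed by
    vectors of integers below [b^n].  Let [lam a] be the proportion of sample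
    points whose digits start with those of the cell [a], minus the volume of
    [a].  Only the digits of the points in [G^s] matter here: a point of [G^s]
    with a tail of digits [b-1] is still projected into the closure of its
    cell, so its non-unique expansion is harmless.

    On the one hand, [f |-> mean f - \int f] differs from
    [f |-> \sum_a lam a * f (corner a)] by at most [o(1) * |f|], by uniform
    continuity of [K] on the cube; hence the worst-case error is the limit of
    the norms of the representers [\sum_a lam a *: K(., corner a)], whose
    squares are [\sum_(a, a') lam a * lam a' * K (corner a) (corner a')].

    On the other hand, the Walsh functions of index below [b^n] are constant on
    cells, and the transform of [lam] is the indicator of the nonzero [k] in the
    dual net with [delta k = 0].  By orthogonality, the sum of [\hat K(k, l)]
    over such [k, l] below [b^n] is
    [\sum_(a, a') lam a * lam a' * (average of K over a x a')], which by uniform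
    continuity has the same limit.  Absolute summability of [\hat K] turns this
    limit along cubes into the sum of the family. *)

(** * Digits and characters *)

Lemma digit_small b k n i : (k < b ^ n)%N -> (n <= i)%N -> digit b k i = 0%N.
Proof.
rewrite /digit => kn ni; case: b kn => [|b] kn.
  case: n ni kn => [|n] ni kn; last by rewrite exp0n in kn.
  by move: kn; rewrite expn0 ltnS leqn0 => /eqP ->; rewrite div0n mod0n.
by rewrite divn_small ?mod0n// (leq_trans kn)// leq_pexp2l.
Qed.

Lemma ltn_digit b k i : (0 < b)%N -> (digit b k i < b)%N.
Proof. by move=> b0; rewrite /digit ltn_mod. Qed.

Lemma digit0 b i : digit b 0 i = 0%N.
Proof. by rewrite /digit div0n mod0n. Qed.

Lemma digitS b k i : digit b k i.+1 = digit b (k %/ b) i.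
Proof. by rewrite /digit expnS divnMA. Qed.

(** The definitions of [wal], [digit_sum] and [dual_net] sum over [i < k], while level-[n]
    computations sum over [i < n]. Both ranges contain all nonzero digits of [k], and zero digits
    contribute nothing. *)
Lemma sum_digit_trunc (V : nmodType) (G : nat -> nat -> V) b k n : (1 < b)%N ->
    (k < b ^ n)%N -> (forall i, G i 0%N = 0) ->
  \sum_(i < k) G i (digit b k i) = \sum_(i < n) G i (digit b k i).
Proof.
move=> b1 kn G0.
suff H p q : (k < b ^ q)%N -> (q <= p)%N ->
    \sum_(i < p) G i (digit b k i) = \sum_(i < q) G i (digit b k i).
  have [nk|/ltnW kn'] := leqP n k; first exact: H.
  (* Since [k < b ^ k], the range [i < k] itself covers all the digits. *)
  by apply/esym/H => //; exact: ltn_expl.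
move=> kq qp; rewrite (big_ord_widen _ (fun i => G i (digit b k i)) qp) [RHS]big_mkcond/=.
apply: eq_bigr => i _; case: ifPn => //; rewrite -leqNgt => qi.
by rewrite (digit_small kq qi).
Qed.

Lemma digit_inj b n k l : (1 < b)%N -> (k < b ^ n)%N -> (l < b ^ n)%N ->
  (forall i, (i < n)%N -> digit b k i = digit b l i) -> k = l.
Proof.
move=> b1; elim: n k l => [|n IHn] k l.
  by rewrite expn0 !ltnS !leqn0 => /eqP -> /eqP ->.
move=> kn ln kl; rewrite (divn_eq k b) (divn_eq l b).
have -> : (k %/ b = l %/ b)%N.
  apply: IHn; rewrite ?ltn_divLR ?(ltnW b1)// -?expnSr// => i i_n.
  by rewrite -!digitS kl.
by have := kl 0%N isT; rewrite /digit expn0 !divn1 => ->.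
Qed.

(* The index of the b-adic interval of level [n] containing the point with
   digits [d]. *)
Fixpoint cell (b : nat) (d : nat -> nat) (n : nat) : nat :=
  if n is n'.+1 then (cell b d n' * b + d n' %% b)%N else 0%N.

Lemma ltn_cell b d n : (0 < b)%N -> (cell b d n < b ^ n)%N.
Proof.
move=> b0; elim: n => [//|n IHn] /=.
have := ltn_pmod (d n) b0; rewrite expnSr; set r := (_ %% _)%N => rb.
by rewrite (leq_trans (n := (cell b d n).+1 * b))// ?leq_mul2r ?IHn ?orbT// mulSn; lia.
Qed.

(** [cell] reads [d] from the most significant digit down, so entry [i] of [d] gets weight
    [b ^ (n - i.+1)]; this is the source of the reversed indices below. *)
Lemma digit_cell b d n i : (0 < b)%N -> (i < n)%N ->
  digit b (cell b d n) (n - i.+1) = (d i %% b)%N.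
Proof.
move=> b0; elim: n i => [//|n IHn] i; rewrite ltnS leq_eqVlt => /predU1P[->|i_n].
  by rewrite subnn /digit expn0 divn1 /= modnMDl modn_mod.
by rewrite subSn// digitS /= divnMDl// divn_small ?ltn_mod// addn0 IHn.
Qed.

Lemma sum_expn (A : nmodType) b n (F : nat -> A) :
  \sum_(k < b ^ n.+1) F k = \sum_(q < b ^ n) \sum_(r < b) F (q * b + r)%N.
Proof.
rewrite expnSr; elim: (b ^ n)%N => [|p IHp]; first by rewrite mul0n !big_ord0.
by rewrite big_ord_recr/= -IHp mulSnr big_split_ord.
Qed.

(** Distributivity, as [k] runs over all digit vectors; the induction peels off the lowest digit by
    [k = q * b + r]. *)
Lemma sum_prod_digit (A : comPzRingType) b n (F : nat -> nat -> A) : (0 < b)%N ->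
  \sum_(k < b ^ n) \prod_(i < n) F i (digit b k i) =
  \prod_(i < n) \sum_(r < b) F i r.
Proof.
move=> b0; elim: n F => [|n IHn] F; first by rewrite big_ord1 !big_ord0.
pose G k := \prod_(i < n.+1) F i (digit b k i).
rewrite (sum_expn b n G) big_ord_recl/= -(IHn (fun i => F i.+1)).
rewrite mulr_sumr; apply: eq_bigr => q _; rewrite mulr_suml; apply: eq_bigr => r _.
rewrite /G big_ord_recl/=; congr (_ * _).
  by rewrite /digit expn0 divn1 modnMDl modn_small.
apply: eq_bigr => i _; rewrite /bump/= add1n.
by rewrite digitS divnMDl// divn_small// addn0.
Qed.

(** * Roots of unity and their orthogonality sums *)

Section omega.
Context {R : realType} (b : nat) (b1 : (1 < b)%N).
Local Notation w := (@omega R b).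
Let b0 : (0 < b)%N := ltnW b1.
Let bn0 : b%:R != 0 :> R. Proof. by rewrite pnatr_eq0 -lt0n. Qed.

Lemma omegaX n :
  w ^+ n = (cos (2 * pi * n%:R / b%:R) +i* sin (2 * pi * n%:R / b%:R))%C.
Proof.
elim: n => [|n IHn]; first by rewrite expr0 mulr0 mul0r cos0 sin0.
rewrite exprSr IHn /omega.
have -> : 2 * pi * n.+1%:R / b%:R = 2 * pi * n%:R / b%:R + 2 * pi / b%:R :> R.
  by rewrite -[n.+1]addn1 (natrD R n 1); ring.
rewrite cosD sinD.
by apply/eqP; rewrite eq_complex/= eqxx/= addrC.
Qed.

Lemma omega_b : w ^+ b = 1.
Proof. by rewrite omegaX mulfK// mulr_natl cos2pi sin2pi. Qed.

Lemma omega_mod n : w ^+ (n %% b) = w ^+ n.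
Proof. by rewrite [in RHS](divn_eq n b) exprD mulnC exprM omega_b expr1n mul1r. Qed.

Lemma omega_eqm m n : m = n %[mod b] -> w ^+ m = w ^+ n.
Proof. by move=> mn; rewrite -(omega_mod m) mn omega_mod. Qed.

Lemma omega_neq1 n : ~~ (b %| n)%N -> w ^+ n != 1.
Proof.
rewrite /dvdn -(omega_mod n) => n0; have := ltn_pmod n b0.
move: n0; set r := (n %% b)%N; rewrite -lt0n => r0 rb.
rewrite omegaX eq_complex/= negb_and; apply/orP; left.
(* The angle is doubled from [pi * r / b], which lies strictly between [0] and [pi]; a cosine equal
   to [1] would force the sine of the half angle to vanish. *)
have -> : 2 * pi * r%:R / b%:R = (pi * r%:R / b%:R) *+ 2 :> R by rewrite -mulr_natl; ring.
rewrite cos_mulr2n; have : 0 < sin (pi * r%:R / b%:R : R).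
  apply: sin_gt0_pi; rewrite -mulrA mulr_gt0 ?pi_gt0 ?divr_gt0 ?ltr0n//=.
  by rewrite gtr_pMr ?pi_gt0// ltr_pdivrMr ?ltr0n// mul1r ltr_nat.
have := cos2Dsin2 (pi * r%:R / b%:R : R); set c := cos _; set t := sin _ => ct t0.
by apply/negP => /eqP h; nra.
Qed.

(** Conjugation becomes a natural power, so that all exponents stay in [nat]. *)
Lemma conj_omega : (w^*)%C = w ^+ b.-1.
Proof.
have ww : w * (w^*)%C = 1.
  apply/eqP; rewrite eq_complex/=; apply/andP; split; apply/eqP; last by ring.
  by have := cos2Dsin2 (2 * pi / b%:R : R); nra.
have h : w * w ^+ b.-1 = 1 by rewrite -exprS prednK ?omega_b.
by transitivity ((w^*)%C * (w * w ^+ b.-1)); [rewrite h mulr1|rewrite mulrCA mulrA ww mul1r].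
Qed.

Lemma conj_omegaX n : ((w ^+ n)^*)%C = w ^+ (b.-1 * n).
Proof. by rewrite exprM -conj_omega; exact: (rmorphXn (@conjc R)). Qed.

Lemma sum_omega (d : nat) :
  \sum_(r < b) w ^+ (r * d) = if (b %| d)%N then b%:R else 0.
Proof.
case: ifPn => bd.
  rewrite (eq_bigr (fun=> 1)) ?sumr_const ?card_ord// => i _.
  by rewrite -omega_mod (eqP (dvdn_mull _ bd)).
have : (w ^+ d - 1) * \sum_(r < b) w ^+ (r * d) = 0.
  rewrite (eq_bigr (fun r : 'I_b => (w ^+ d) ^+ r)); last first.
    by move=> r _; rewrite -exprM mulnC.
  by rewrite -subrX1 -exprM mulnC exprM omega_b expr1n subrr.
by move/eqP; rewrite mulf_eq0 subr_eq0 (negbTE (omega_neq1 bd)) => /eqP.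
Qed.

(** The sum factors over digit positions into geometric sums, each of which is [b] or [0]. *)
Lemma sum_omega_digit n (v : nat -> nat) :
  \sum_(k < b ^ n) w ^+ (\sum_(i < n) digit b k i * v i)%N =
  if [forall i : 'I_n, b %| v i]%N then (b ^ n)%:R else 0.
Proof.
under eq_bigr do rewrite expr_sum.
rewrite (sum_prod_digit _ (fun i r => w ^+ (r * v i)))//.
under eq_bigr do rewrite sum_omega.
case: ifPn => [/forallP vb|/forallPn[i vi]].
  by under eq_bigr do rewrite vb; rewrite prodr_const card_ord natrX.
by rewrite (bigD1 i)//= (negbTE vi) mul0r.
Qed.

End omega.

(** * Walsh functions as characters on cells, and their sums over the net *)

Section cell_characters.
Context {R : realType} (b : nat) (b1 : (1 < b)%N).
Local Notation w := (@omega R b).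
Let b0 : (0 < b)%N := ltnW b1.

(** This is the constant value on the level-[n] cell [a] of the Walsh function of index [k < b ^ n]:
    digit [i] of [k] meets the [i.+1]-st b-adic digit of the cell. *)
Definition chi (n k a : nat) : R[i] :=
  w ^+ (\sum_(i < n) digit b k i * digit b a (n - i.+1))%N.

Lemma chiC n k a : chi n k a = chi n a k.
Proof.
rewrite /chi (reindex_inj rev_ord_inj)/=; congr (_ ^+ _); apply: eq_bigr => i _.
by rewrite mulnC; congr (digit _ _ _ * _)%N; rewrite subnSK// subKn// ltnW.
Qed.

Lemma chi0 n a : chi n 0 a = 1.
Proof. by rewrite /chi big1 ?expr0// => i _; rewrite digit0. Qed.

Lemma chi_cell n k d : chi n k (cell b d n) = w ^+ (\sum_(i < n) digit b k i * d i)%N.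
Proof.
rewrite /chi !expr_sum; apply: eq_bigr => i _.
by rewrite digit_cell//; apply: (omega_eqm b1); rewrite modnMmr.
Qed.

Lemma sum_chi_orth n a a' : (a < b ^ n)%N -> (a' < b ^ n)%N ->
  \sum_(k < b ^ n) ((chi n k a)^*)%C * chi n k a' = if a == a' then (b ^ n)%:R else 0.
Proof.
move=> an a'n.
pose v i := (b.-1 * digit b a (n - i.+1) + digit b a' (n - i.+1))%N.
rewrite (eq_bigr (fun k : 'I_(b ^ n) => w ^+ (\sum_(i < n) digit b k i * v i)%N)).
  rewrite sum_omega_digit//; congr (if _ then _ else _).
  apply/forallP/eqP => [h|aa' i].
    apply: (digit_inj b1 an a'n) => i i_n.
    have ni : (n - i.+1 < n)%N by lia.
    have := h (Ordinal ni); rewrite /v/= subnSK// subKn; last exact: ltnW.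
    have := ltn_digit a i b0; have := ltn_digit a' i b0.
    move: (digit b a i) (digit b a' i) => x y yb xb.
    (* Modulo [b], the number [(b - 1) * x + y] is [y - x], which lies strictly between [-b] and
       [b]. Truncated subtraction requires both orders to be treated. *)
    move=> h'; have [xy|xy|//] := ltngtP x y; exfalso.
      have : (b %| y - x)%N.
        rewrite -(dvdn_addr _ (dvdn_mulr x (dvdnn b))); rewrite -subn1 in h'.
        by rewrite (_ : (b * x + (y - x) = (b - 1) * x + y)%N)//; nia.
      by move/dvdn_leq; lia.
    have : (b %| x - y)%N.
      have h2 : ((b - 1) * x + y + (x - y) = b * x)%N by nia.
      by rewrite -subn1 in h'; rewrite -(dvdn_addr _ h') h2 dvdn_mulr.
    by move/dvdn_leq; lia.
  by rewrite /v aa' -mulSnr prednK// dvdn_mulr.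
move=> k _; rewrite /chi conj_omegaX// -exprD big_distrr -big_split/=.
by congr (_ ^+ _); apply: eq_bigr => i _; rewrite /v; ring.
Qed.

Lemma sum_chi n k : (k < b ^ n)%N ->
  \sum_(a < b ^ n) chi n k a = if k == 0%N then (b ^ n)%:R else 0.
Proof.
move=> kn; rewrite eq_sym -(sum_chi_orth _ kn) ?expn_gt0 ?b0//.
by apply: eq_bigr => a _; rewrite chiC [chi n a 0]chiC chi0 conjc1 mul1r chiC.
Qed.

Context (s : nat).

Definition mchi n (k a : {ffun 'I_s -> 'I_(b ^ n)}) : R[i] :=
  \prod_(j < s) chi n (k j) (a j).

Lemma sum_mchi_orth n (a a' : {ffun 'I_s -> 'I_(b ^ n)}) :
  \sum_k ((mchi k a)^*)%C * mchi k a' = if a == a' then ((b ^ n) ^ s)%:R else 0.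
Proof.
rewrite /mchi; under eq_bigr do rewrite rmorph_prod/= -big_split/=.
rewrite -(bigA_distr_bigA (fun j (k : 'I_(b ^ n)) =>
  ((chi n k (a j))^*)%C * chi n k (a' j)))/=.
under eq_bigr do rewrite sum_chi_orth//.
case: eqP => [->|aa'].
  by under eq_bigr do rewrite eqxx; rewrite prodr_const card_ord -natrX.
have /existsP[j aj] : [exists j, a j != a' j].
  by apply: contra_notT aa' => /existsPn h; apply/ffunP => j; apply/eqP/negPn; exact: h.
by rewrite (bigD1 j)//= ifN// mul0r.
Qed.

Lemma sum_mchi n (k : {ffun 'I_s -> 'I_(b ^ n)}) :
  \sum_a mchi k a = if [forall j, k j == 0%N :> nat] then ((b ^ n) ^ s)%:R else 0.
Proof.
rewrite -(bigA_distr_bigA (fun j (a : 'I_(b ^ n)) => chi n (k j) a))/=.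
under eq_bigr do rewrite sum_chi//.
case: ifPn => [/forallP k0|/forallPn[j kj]].
  by under eq_bigr do rewrite k0; rewrite prodr_const card_ord -natrX.
by rewrite (bigD1 j)//= ifN// mul0r.
Qed.

Definition mcell (n : nat) (d : 'I_s -> nat -> nat) : {ffun 'I_s -> 'I_(b ^ n)} :=
  [ffun j => Ordinal (ltn_cell (d j) n b0)].

Lemma mchi_cell n k d :
  mchi k (mcell n d) = w ^+ (\sum_(j < s) \sum_(i < n) digit b (k j) i * d j i)%N.
Proof.
by rewrite expr_sum; apply: eq_bigr => j _; rewrite ffunE/= chi_cell.
Qed.

Definition tuple_of_cell n (k : {ffun 'I_s -> 'I_(b ^ n)}) : s.-tuple nat :=
  [tuple (k j : nat) | j < s].

Lemma tnth_tuple_of_cell n (k : {ffun 'I_s -> 'I_(b ^ n)}) j :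
  tnth (tuple_of_cell k) j = k j.
Proof. by rewrite tnth_mktuple. Qed.

Lemma omega_Zp_nat n : w ^+ (n%:R : 'Z_b) = w ^+ n.
Proof. by rewrite val_Zp_nat// omega_mod. Qed.

Lemma big_Zp (V : nmodType) (F : nat -> V) : \sum_(l : 'Z_b) F l = \sum_(l < b) F l.
Proof. by rewrite -!(big_mkord xpredT F) Zp_cast. Qed.

Lemma dvdn_Zp (x : 'Z_b) : (b %| x)%N = (x == 0).
Proof.
rewrite -val_eqE/= /dvdn modn_small//.
by rewrite -[X in (_ < X)%N](Zp_cast b1) ltn_ord.
Qed.

Lemma mdigit_sum_eq0 n (k : {ffun 'I_s -> 'I_(b ^ n)}) :
  (mdigit_sum b (tuple_of_cell k) == 0%N) =
  (b %| \sum_(j < s) \sum_(i < n) digit b (k j) i)%N.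
Proof.
rewrite /mdigit_sum /digit_sum modn_summ /dvdn; congr (_ %% _ == _)%N.
apply: eq_bigr => j _; rewrite tnth_tuple_of_cell.
by rewrite (@sum_digit_trunc nat (fun _ => id) b (k j) n).
Qed.

Lemma dual_netE m (C : 'I_s -> nat -> 'rV['Z_b]_m) n (k : {ffun 'I_s -> 'I_(b ^ n)}) :
  dual_net C (tuple_of_cell k) <->
  forall c, \sum_(j < s) \sum_(i < n) (digit b (k j) i)%:R * C j i ord0 c = 0.
Proof.
have E : \sum_(j < s) \sum_(i < tnth (tuple_of_cell k) j)
             (digit b (tnth (tuple_of_cell k) j) i)%:R *: C j i =
   \sum_(j < s) \sum_(i < n) (digit b (k j) i)%:R *: C j i.
  apply: eq_bigr => j _; rewrite tnth_tuple_of_cell.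
  by apply: (sum_digit_trunc (G := fun i d => d%:R *: C j i)) => // i; rewrite scale0r.
rewrite /dual_net/= E; split=> [/rowP h c|h].
  have := h c; rewrite mxE summxE => h'; rewrite -[RHS]h'.
  by apply: eq_bigr => j _; rewrite summxE; apply: eq_bigr => i _; rewrite mxE.
apply/rowP => c; rewrite mxE summxE -[RHS](h c).
by apply: eq_bigr => j _; rewrite summxE; apply: eq_bigr => i _; rewrite mxE.
Qed.

(** At the point [(l, h)] the exponent is, modulo [b], [l * S] plus the pairing of the digits of [h]
    with [V]. The sum over the shifts [l] tests [b %| S], i.e. digit sum zero; the sum over [h]
    tests [V = 0], i.e. membership in the dual net. *)
Lemma sum_mchi_antithetic m (C : 'I_s -> nat -> 'rV['Z_b]_m) n
    (k : {ffun 'I_s -> 'I_(b ^ n)}) :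
  \sum_p mchi k (mcell n (fun j i => antithetic (digital_net C) p j i : nat)) =
  if `[< dual_net C (tuple_of_cell k) /\ mdigit_sum b (tuple_of_cell k) = 0%N >]
  then (b * b ^ m)%:R else 0.
Proof.
pose V (c : 'I_m) : 'Z_b :=
  \sum_(j < s) \sum_(i < n) (digit b (k j) i)%:R * C j i ord0 c.
(* [v] extends [V] by zero to all of [nat], the form expected by [sum_omega_digit]. *)
pose v (c : nat) : nat := if insub c is Some c' then V c' : nat else 0%N.
have vE (c : 'I_m) : v c = V c by rewrite /v valK.
pose S := (\sum_(j < s) \sum_(i < n) digit b (k j) i)%N.
rewrite (eq_bigr (fun p : 'Z_b * 'I_(b ^ m) =>
  w ^+ (p.1 * S)%N * w ^+ (\sum_(c < m) digit b p.2 c * v c)%N)); last first.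
  (* Exponents of [omega] matter only modulo [b], so they are compared in ['Z_b]. *)
  move=> [l h] _; rewrite mchi_cell -exprD -omega_Zp_nat -[RHS]omega_Zp_nat.
  congr (_ ^+ nat_of_ord _); rewrite natrD natrM natr_Zp !natr_sum.
  under [X in _ + X]eq_bigr do rewrite natrM vE natr_Zp /V mulr_sumr.
  rewrite exchange_big/= mulr_sumr -big_split/=; apply: eq_bigr => j _.
  under [X in _ + X]eq_bigr do rewrite mulr_sumr.
  rewrite exchange_big/= !natr_sum mulr_sumr -big_split/=; apply: eq_bigr => i _.
  rewrite natrM; transitivity ((digit b (k j) i)%:R * (digital_net C h j i + l)).
    by congr (_ * _); exact: (natr_Zp (digital_net C h j i + l)).
  rewrite /digital_net mulrDr mulr_sumr [RHS]addrC.
  congr (_ + _); last exact: mulrC.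
  by apply: eq_bigr => c _; ring.
rewrite -(pair_bigA _ (fun (l : 'Z_b) (h : 'I_(b ^ m)) =>
  w ^+ (l * S)%N * w ^+ (\sum_(c < m) digit b h c * v c)%N))/=.
rewrite -big_distrlr/= (big_Zp (fun l => w ^+ (l * S)%N)) sum_omega// sum_omega_digit//.
rewrite -mdigit_sum_eq0; case: asboolP => [[/dual_netE dk /eqP ->]|h].
  by rewrite ifT ?natrM//; apply/forallP => c; rewrite vE dvdn_Zp /V dk.
case: eqP => [d0|]; last by rewrite mul0r.
case: ifPn => [/forallP h'|]; last by rewrite mulr0.
exfalso; apply: h; split => //; apply/dual_netE => c.
by have := h' c; rewrite vE dvdn_Zp => /eqP.
Qed.

End cell_characters.

(** * Cells of the unit cube *)

Section cell_points.
Context {R : realType} (b : nat) (b1 : (1 < b)%N).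
Let b0 : (0 < b)%N := ltnW b1.
Let bX0 n : 0 < b%:R ^+ n :> R. Proof. by rewrite exprn_gt0// ltr0n. Qed.
Let bXn0 n : b%:R ^+ n != 0 :> R. Proof. by rewrite gt_eqF. Qed.

(** Appending [k] digits multiplies the index by [b ^ k] and adds at most [b ^ k - 1]. *)
Lemma cell_addn d n k :
  (cell b d n * b ^ k <= cell b d (n + k) <= (cell b d n).+1 * b ^ k - 1)%N.
Proof.
elim: k => [|k /andP[h1 h2]]; first by rewrite addn0 expn0; lia.
rewrite addnS/= expnSr; have := ltn_pmod (d (n + k)%N) b0.
set r := (_ %% _)%N; move: h1 h2; have : (0 < b ^ k)%N by rewrite expn_gt0 b0.
by move: (b ^ k)%N (cell _ _ _) (cell _ _ _) => *; nia.
Qed.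

Lemma sum_cell (d : nat -> nat) n : (forall i, (d i < b)%N) ->
  \sum_(i < n) ((d i)%:R * b%:R ^- i.+1 : R) = (cell b d n)%:R / b%:R ^+ n.
Proof.
move=> db; elim: n => [|n IHn]; first by rewrite big_ord0 mul0r.
rewrite big_ord_recr/= IHn modn_small// natrD natrM exprS.
by have := bXn0 n; have := bXn0 1; rewrite expr1 => ? ?; field; apply/andP.
Qed.

(** All partial sums from rank [n] on lie in the closed cell, hence so does the limit. As no
    uniqueness of the expansion is involved, this covers both [rdigit] and points of [G] ending in
    digits [b-1]. *)
Lemma cell_cvg_itv (d : nat -> nat) (x : R) n : (forall i, (d i < b)%N) ->
  (fun n => \sum_(i < n) ((d i)%:R * b%:R ^- i.+1 : R)) @ \oo --> x ->
  (cell b d n)%:R / b%:R ^+ n <= x <= (cell b d n).+1%:R / b%:R ^+ n.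
Proof.
move=> db dx; rewrite -(cvg_lim (@Rhausdorff R) dx).
have dc : cvgn (fun n => \sum_(i < n) ((d i)%:R * b%:R ^- i.+1 : R)).
  by apply/cvg_ex; exists x.
apply/andP; split; [apply: limr_ge => //|apply: limr_le => //]; exists n => // k /= nk.
- rewrite sum_cell// ler_pdivrMr// mulrAC ler_pdivlMr//.
  have /andP[+ _] := cell_addn d n (k - n); rewrite subnKC// -!natrX -!natrM ler_nat.
  rewrite (_ : b ^ k = b ^ n * b ^ (k - n))%N; last by rewrite -expnD subnKC.
  by have : (0 < b ^ n)%N by [rewrite expn_gt0 b0]; nia.
- rewrite sum_cell// ler_pdivrMr// mulrAC ler_pdivlMr//.
  have /andP[_] := cell_addn d n (k - n); rewrite subnKC// -!natrX -!natrM ler_nat.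
  rewrite (_ : b ^ k = b ^ n * b ^ (k - n))%N; last by rewrite -expnD subnKC.
  by have : (0 < b ^ n)%N by [rewrite expn_gt0 b0]; nia.
Qed.

Lemma ltn_rdigit (x : R) i : (rdigit b x i < b)%N.
Proof. by rewrite /rdigit; case: ifP; rewrite ?ltn_mod// prednK. Qed.

Lemma rdigit_cell_itv (x : R) n : 0 <= x <= 1 ->
  (cell b (rdigit b x) n)%:R / b%:R ^+ n <= x <=
  (cell b (rdigit b x) n).+1%:R / b%:R ^+ n.
Proof. by move=> x01; apply: cell_cvg_itv; [exact: ltn_rdigit|exact: cvg_rdigit]. Qed.

Lemma ltn_Zp (x : 'Z_b) : (x < b)%N.
Proof. by rewrite -[X in (_ < X)%N](Zp_cast b1). Qed.

Lemma badic_proj_cell_itv (z : nat -> 'Z_b) n :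
  (cell b (fun i => z i : nat) n)%:R / b%:R ^+ n <= badic_proj z :> R /\
  badic_proj z <= (cell b (fun i => z i : nat) n).+1%:R / b%:R ^+ n :> R.
Proof.
have zb i : (z i < b)%N by exact: ltn_Zp.
apply/andP; apply: cell_cvg_itv => //.
(* [badic_proj] is a [limn], so convergence must be established: the partial sums increase and are
   bounded by [1]. *)
apply: (@nondecreasing_is_cvgn R).
  apply/nondecreasing_seqP => k; rewrite big_ord_recr/= lerDl.
  by rewrite mulr_ge0// invr_ge0 ltW.
exists 1 => _ [k _ <-]; rewrite (@sum_cell (fun i => z i : nat))//.
by rewrite ler_pdivrMr// mul1r -natrX ler_nat ltnW// ltn_cell.
Qed.

Lemma badic_proj01 (z : nat -> 'Z_b) : 0 <= (badic_proj z : R) <= 1.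
Proof.
by have [] := badic_proj_cell_itv z 0; rewrite /= expr0 !divr1 => -> ->.
Qed.

(** Membership is decided by digits rather than by endpoints, so the boxes partition the closed
    interval exactly, [1] falling in the last one. *)
Definition box1 (n a : nat) : set (measurableTypeR R) :=
  [set x : R | 0 <= x <= 1 /\ cell b (rdigit b x) n = a].

Let u n (a : nat) : R := a%:R / b%:R ^+ n.

Lemma box1_sub n a : box1 n a `<=` `[u n a, u n a.+1]%classic.
Proof.
by move=> x [x01 <-]; rewrite /= in_itv/=; exact: rdigit_cell_itv.
Qed.

Lemma sub_box1 n a : (a < b ^ n)%N -> `]u n a, u n a.+1[%classic `<=` box1 n a.
Proof.
move=> an x; rewrite /= in_itv/= /u ltr_pdivrMr// ltr_pdivlMr// => /andP[ax xa].
have x01 : 0 <= x <= 1.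
  rewrite -(pmulr_lge0 _ (bX0 n)) (le_trans _ (ltW ax))//=.
  rewrite -(ler_pM2r (bX0 n)) mul1r (le_trans (ltW xa))//.
  by rewrite -natrX ler_nat.
split=> //; have := rdigit_cell_itv n x01; set c := cell _ _ _.
rewrite ler_pdivrMr// ler_pdivlMr// => /andP[cx xc].
have := le_lt_trans cx xa; have := lt_le_trans ax xc; rewrite !ltr_nat !ltnS => ac ca.
by apply/eqP; rewrite eqn_leq ca ac.
Qed.

(** The box lies between an open interval and its closure, so it is that open interval plus at most
    two points. *)
Lemma measurable_box1 n a : (a < b ^ n)%N -> measurable (box1 n a).
Proof.
move=> an.
have sub1 (x : measurableTypeR R) : measurable (box1 n a `&` [set x]).
  have [->|->] : box1 n a `&` [set x] = set0 \/ box1 n a `&` [set x] = [set x].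
  - by apply/subset_set1; exact: subIsetr.
  - exact: measurable0.
  - exact: measurable_set1.
rewrite (_ : box1 n a = `]u n a, u n a.+1[%classic `|`
    ((box1 n a `&` [set u n a]) `|` (box1 n a `&` [set u n a.+1]))).
  apply: measurableU; first exact: measurable_itv.
  by apply: measurableU.
apply/seteqP; split=> [x bx|x]; last first.
  by move=> [/(sub_box1 an)//|[[]//|[]//]].
have := box1_sub bx; rewrite /= !in_itv/= !le_eqVlt.
move=> /andP[/predU1P[h1|h1]]; first by move=> _; right; left; split.
move=> /predU1P[h2|h2]; first by right; right; split.
by left; rewrite h1 h2.
Qed.

Lemma lebesgue_box1 n a : (a < b ^ n)%N ->
  lebesgue_measure (box1 n a) = (b%:R ^- n)%:E :> \bar R.
Proof.
move=> an; have E : u n a.+1 - u n a = b%:R ^- n.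
  by rewrite /u -mulrBl -natrB// subSnn mul1r.
have uu : u n a < u n a.+1 by rewrite -subr_gt0 E invr_gt0.
apply/eqP; rewrite eq_le -E; apply/andP; split.
  apply: (@le_trans _ _ (lebesgue_measure `[u n a, u n a.+1]%classic)).
    apply: le_measure; rewrite ?inE; [exact: measurable_box1|exact: measurable_itv|].
    exact: box1_sub.
  by rewrite lebesgue_measure_itv/= lte_fin uu EFinB.
apply: (@le_trans _ _ (lebesgue_measure `]u n a, u n a.+1[%classic)).
  by rewrite lebesgue_measure_itv/= lte_fin uu EFinB.
apply: le_measure; rewrite ?inE; [exact: measurable_itv|exact: measurable_box1|].
exact: sub_box1.
Qed.

Context (s : nat).

Definition box n (a : {ffun 'I_s -> 'I_(b ^ n)}) : set (s.-tuple (measurableTypeR R)) :=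
  [set x | forall j, box1 n (a j) (tnth x j)].

Definition corner n (a : {ffun 'I_s -> 'I_(b ^ n)}) : s.-tuple R :=
  [tuple (a j)%:R / b%:R ^+ n | j < s].

Lemma measurable_box n a : measurable (@box n a).
Proof.
apply: (@measurable_tuple_box R s (fun j => box1 n (a j))) => j.
exact: measurable_box1.
Qed.

Lemma lebesgue_box n a : lebesgue_tuple s (@box n a) = ((b ^ n) ^ s)%:R^-1%:E.
Proof.
rewrite (@lebesgue_tuple_box R s (fun j => box1 n (a j))); last first.
  by move=> j; exact: measurable_box1.
under eq_bigr do rewrite lebesgue_box1//.
rewrite big_const_ord; elim: s => [|k /= ->]; first by rewrite expn0 invr1.
by rewrite -EFinM -natrX -invfM -natrM expnS.
Qed.

Lemma box_cell (x : s.-tuple R) n :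
  unit_cube s x -> box (mcell b1 n (fun j => rdigit b (tnth x j))) x.
Proof. by move=> xc j; split; [have := xc j; rewrite in_itv|rewrite ffunE]. Qed.

Lemma box_cellE n a (x : s.-tuple R) : @box n a x ->
  a = mcell b1 n (fun j => rdigit b (tnth x j)).
Proof.
by move=> ax; apply/ffunP => j; apply/val_inj; rewrite ffunE/=; have [_ <-] := ax j.
Qed.

Lemma box_cube n a : @box n a `<=` unit_cube s.
Proof. by move=> x ax j; rewrite in_itv/=; have [] := ax j. Qed.

Lemma unit_cube_box n : unit_cube s = \big[setU/set0]_a @box n a.
Proof.
rewrite -bigcup_seq; apply/seteqP; split => [x xc|x [a _]]; last exact: box_cube.
by eexists; last exact: box_cell; exact: mem_index_enum.
Qed.

Lemma corner_cube n a : unit_cube s (@corner n a).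
Proof.
move=> j; rewrite tnth_mktuple in_itv/= divr_ge0 ?ler0n ?(ltW (bX0 _))//=.
by rewrite ler_pdivrMr// mul1r -natrX ler_nat ltnW.
Qed.

Lemma corner_near_box n a x : @box n a x ->
  forall j, `|tnth x j - tnth (corner a) j| <= b%:R ^- n.
Proof.
move=> ax j; rewrite tnth_mktuple; have /box1_sub := ax j.
rewrite /= in_itv/= /u => /andP[h1 h2].
rewrite ger0_norm ?subr_ge0// lerBlDl (le_trans h2)//.
by rewrite -natr1 mulrDl mul1r.
Qed.

(** The cell is that of the digits of [z], possibly not the one assigned by [rdigit] to the
    projected point; lying in the closed cell is enough for the distance bound. *)
Lemma corner_near_proj n (z : 'I_s -> nat -> 'Z_b) j :
  `|tnth (badic_mproj z : s.-tuple R) j -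
    tnth (corner (mcell b1 n (fun j i => z j i : nat))) j| <= b%:R ^- n.
Proof.
rewrite !tnth_mktuple ffunE/=; have [h1 h2] := badic_proj_cell_itv (z j) n.
rewrite ger0_norm ?subr_ge0// lerBlDl (le_trans h2)//.
by rewrite -natr1 mulrDl mul1r.
Qed.

Lemma badic_mproj_cube (z : 'I_s -> nat -> 'Z_b) :
  unit_cube s (badic_mproj z : s.-tuple R).
Proof. by move=> j; rewrite tnth_mktuple in_itv/= badic_proj01. Qed.

End cell_points.

(** * Integrals of uniform limits of step functions *)

Section step_approximation.
Context d (T : measurableType d) (R : realType) (mu : {measure set T -> \bar R}).

Lemma measurable_fun_bigsetU_seq (I : eqType) (B : I -> set T) (f : T -> R) (r : seq I) :
  (forall a, measurable (B a)) -> (forall a, measurable_fun (B a) f) ->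
  measurable_fun (\big[setU/set0]_(a <- r) B a) f.
Proof.
move=> mB mf; elim: r => [|a r IHr]; first by rewrite big_nil; exact: measurable_fun_set0.
rewrite big_cons; apply/measurable_funU => //; exact: bigsetU_measurable.
Qed.

Lemma Rintegral_partition (I : finType) (B : I -> set T) (f : T -> R) :
  (forall a, measurable (B a)) -> trivIset setT B ->
  (forall a, mu.-integrable (B a) (EFin \o f)) ->
  \int[mu]_(x in \big[setU/set0]_a B a) f x = \sum_a \int[mu]_(x in B a) f x.
Proof.
move=> mB tB fB; rewrite /Rintegral integral_bigsetU_EFin//.
- by rewrite -sum_fine// => a _; exact: integrable_fin_num.
- exact: index_enum_uniq.
- exact: sub_trivIset tB.
- apply/measurable_EFinP/measurable_fun_bigsetU_seq => // a.
  by apply/measurable_EFinP; exact: (measurable_int mu).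
Qed.

Lemma Rintegral_near_cst (B : set T) (f : T -> R) (c e : R) :
  measurable B -> (mu B < +oo)%E -> mu.-integrable B (EFin \o f) ->
  (forall x, B x -> `|f x - c| <= e) ->
  `|\int[mu]_(x in B) f x - c * fine (mu B)| <= e * fine (mu B).
Proof.
move=> mB Boo fB fc; rewrite -!Rintegral_cst//.
have ic (r : R) : mu.-integrable B (EFin \o (fun=> r)).
  apply: measurable_bounded_integrable => //.
  by exists `|r|; split; [exact: num_real|move=> M rM x _ /=; exact: ltW].
rewrite -RintegralB//; apply: le_trans; first apply: le_normr_Rintegral => //.
  by have := integrableB mB fB (ic c).
apply: le_Rintegral => //.
by have := integrable_abse (integrableB mB fB (ic c)).
Qed.

(** Uniform limits of finite step functions. Uniformly continuous functions on the cube are of this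
    kind with the boxes as steps, which yields their measurability and integrability from that of
    the boxes. *)
Definition regulated (D : set T) (f : T -> R) :=
  forall e : R, 0 < e -> exists (I : finType) (B : I -> set T) (c : I -> R),
    [/\ forall a, measurable (B a), trivIset setT B,
        D `<=` \big[setU/set0]_a B a &
        forall a x, D x -> B a x -> `|f x - c a| <= e].

Lemma regulated_measurable D f : regulated D f -> measurable_fun D f.
Proof.
move=> rf.
have e0 n : 0 < (n.+1%:R^-1 : R) by rewrite invr_gt0 ltr0n.
have /choice[h hf] : forall n : nat, exists h : T -> R,
    measurable_fun D h /\ forall x, D x -> `|f x - h x| <= n.+1%:R^-1.
  move=> n; have [I [B [c [mB tB DB fB]]]] := rf _ (e0 n).
  exists (fun x => \sum_a c a * \1_(B a) x); split.
    apply: measurable_funTS; apply: measurable_sum => a.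
    by apply: measurable_funM => //; exact: measurable_indic.
  move=> x Dx; have := DB _ Dx; rewrite -bigcup_seq => -[a _ Bax].
  rewrite (bigD1 a)//= big1 ?addr0 => [|a' a'a].
    by rewrite indicE mem_set// mulr1; exact: fB.
  rewrite indicE memNset ?mulr0// => Ba'x.
  have : a' = a by apply: tB => //; exists x.
  exact/eqP.
apply: (measurable_fun_cvg (h := h)) => [n|x Dx]; first by have [] := hf n.
apply/cvgrPdist_le => e e_gt0; near=> n.
have [_ /(_ _ Dx) /le_trans] := hf n; apply.
by apply: ltW; near: n; exact: (near_infty_natSinv_lt (PosNum e_gt0)).
Unshelve. all: by end_near. Qed.

Lemma regulated_integrable D f : measurable D -> (mu D < +oo)%E ->
  regulated D f -> mu.-integrable D (EFin \o f).
Proof.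
move=> mD Doo rf; apply: measurable_bounded_integrable => //.
  exact: regulated_measurable.
have [I [B [c [mB tB DB fB]]]] := rf 1 ltr01.
(* The sum dominates each [|c a|], and [1] is the step tolerance chosen just above. *)
exists (\sum_a `|c a| + 1); split; first exact: num_real.
move=> M cM x Dx /=; apply/ltW/(le_lt_trans _ cM).
have := DB _ Dx; rewrite -bigcup_seq => -[a _ Bax].
rewrite -[f x](subrK (c a)) addrC (le_trans (ler_normD _ _))// lerD//; last exact: fB.
by rewrite (bigD1 a)//= lerDl sumr_ge0.
Qed.

End step_approximation.

Lemma complex_integral_partition d (T : measurableType d) (R : realType)
    (mu : {measure set T -> \bar R}) (I : finType) (B : I -> set T)
    (f : T -> R) (g : T -> R[i]) (c : I -> R[i]) :
  (forall a, measurable (B a)) -> trivIset setT B ->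
  (forall a, mu.-integrable (B a) (EFin \o f)) ->
  (forall a x, B a x -> g x = (f x)%:C%C * c a) ->
  complex_integral mu (\big[setU/set0]_a B a) g =
  \sum_a (\int[mu]_(x in B a) f x)%:C%C * c a.
Proof.
move=> mB tB fB gf.
(* [p] stands for the real or the imaginary part, both homogeneous for real factors. *)
have part (p : R[i] -> R) (pM : forall (r : R) z, p (r%:C%C * z) = r * p z) :
    \int[mu]_(x in \big[setU/set0]_a B a) p (g x) =
    \sum_a \int[mu]_(x in B a) f x * p (c a).
  have pB a : {in B a, (fun x => (f x * p (c a))%:E) =1 EFin \o (fun x => p (g x))}.
    by move=> x /set_mem Bx /=; rewrite (gf _ _ Bx) pM.
  rewrite Rintegral_partition// => [|a].
    apply: eq_bigr => a _; rewrite -RintegralZr//.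
    by apply: eq_Rintegral => x /set_mem Bx; rewrite (gf _ _ Bx) pM.
  apply: (eq_integrable (mB a) _ _ (pB a)).
  by under eq_fun do rewrite EFinM; exact: integrableZr.
rewrite /complex_integral (part (@complex.Re R)); last by move=> r [x y] /=; ring.
rewrite (part (@complex.Im R)); last by move=> r [x y] /=; ring.
by elim/big_rec3: _ => // a x y z _ <-; case: (c a) => u v; simpc.
Qed.

(** * Uniform continuity of the kernel *)

Section uniform_continuity.
Context {R : realType} (s : nat).

Definition close (r : R) (x y : s.-tuple R) := forall j, `|tnth x j - tnth y j| <= r.

Lemma closeC r x y : close r x y -> close r y x.
Proof. by move=> xy j; rewrite distrC. Qed.

Lemma close_trans r1 r2 x y z : close r1 x y -> close r2 y z -> close (r1 + r2) x z.
Proof.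
move=> xy yz j; rewrite -(subrKA (tnth y j)) (le_trans (ler_normD _ _))//.
by rewrite lerD.
Qed.

Lemma le_close r1 r2 x y : r1 <= r2 -> close r1 x y -> close r2 x y.
Proof. by move=> r12 xy j; exact: le_trans r12. Qed.

Lemma close_refl r x : 0 <= r -> close r x x.
Proof. by move=> r0 j; rewrite subrr normr0. Qed.

Lemma nbhs_tuple (x : s.-tuple R) (U : set (s.-tuple R)) : nbhs x U ->
  exists2 r : R, 0 < r & close r x `<=` U.
Proof.
case=> _ [[V oV <-] /= Vx VU].
have : nbhs (\row_(i < s) tnth x i) V by exact: open_nbhs_nbhs.
move=> /nbhs_ballP[e /= e0 eV].
(* Halving passes from the strict inequality of balls to the large one of [close]. *)
exists (e / 2); first by rewrite divr_gt0.
move=> y xy; apply: VU => /=; apply: eV; split => // i j; rewrite !mxE /ball/=.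
by rewrite (le_lt_trans (xy j))// ltr_pdivrMr// ltr_pMr// ltr1n.
Qed.

(** Heine-Cantor. Compactness is taken from boxes of row vectors, to which [tup] transports the
    cube, in its near-covering form: a property holding locally for all small [r] holds on the whole
    compact set for all small [r]. *)
Lemma unit_cube2_unif_continuous (K : s.-tuple R -> s.-tuple R -> R) :
  {within unit_cube s `*` unit_cube s, continuous (fun p => K p.1 p.2)} ->
  forall e : R, 0 < e -> exists2 r : R, 0 < r &
    forall x y x' y', unit_cube s x -> unit_cube s y -> unit_cube s x' ->
      unit_cube s y' -> close r x x' -> close r y y' -> `|K x y - K x' y'| <= e.
Proof.
move=> /subspace_continuousP Kc e e0.
have e20 : 0 < e / 2 by rewrite divr_gt0.
have loc x y : unit_cube s x -> unit_cube s y -> exists2 r : R, 0 < r &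
    forall x' y', unit_cube s x' -> unit_cube s y' ->
      close r x x' -> close r y y' -> `|K x y - K x' y'| <= e / 2.
  move=> xc yc; have /cvgrPdist_le /(_ _ e20) := Kc (x, y) (conj xc yc).
  rewrite near_withinE => -[[U V] /= [Ux Vy] UV].
  have [r r0 rU] := nbhs_tuple Ux; have [t t0 tV] := nbhs_tuple Vy.
  exists (Num.min r t); first by rewrite lt_min r0.
  move=> x' y' x'c y'c xx' yy'; apply: (UV (x', y')) => //; split.
    by apply: rU; apply: le_close xx'; rewrite ge_min lexx.
  by apply: tV; apply: le_close yy'; rewrite ge_min lexx orbT.
pose A : set 'rV[R]_s := [set v | forall i, `[0, 1]%classic (v ord0 i)].
pose tup (v : 'rV[R]_s) : s.-tuple R := [tuple v ord0 j | j < s].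
have tupK (x : s.-tuple R) : tup (\row_j tnth x j) = x.
  by apply: eq_from_tnth => j; rewrite tnth_mktuple mxE.
have tupc v : A v -> unit_cube s (tup v).
  by move=> Av j; rewrite tnth_mktuple; exact: Av.
have cAA : compact (A `*` A).
  by apply: compact_setX; apply: (@rV_compact R s (fun=> `[0, 1]%classic)) => i;
    exact: segment_compact.
pose P (r : R) (p : 'rV[R]_s * 'rV[R]_s) := forall x' y', unit_cube s x' ->
  unit_cube s y' -> close r (tup p.1) x' -> close r (tup p.2) y' ->
  `|K (tup p.1) (tup p.2) - K x' y'| <= e.
have : \forall r \near (0:R)^'+, A `*` A `<=` P r.
  move/compact_near_coveringP/near_covering_withinP : cAA; apply.
  move=> [v w] [/= Av Aw]; have [r r0 rK] := loc _ _ (tupc _ Av) (tupc _ Aw).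
  have r20 : 0 < r / 2 by rewrite divr_gt0.
  (* One half of [r] absorbs the move of the base point, the other the tested distance [t]. *)
  exists ((ball v (r / 2) `*` ball w (r / 2)), [set t : R | t <= r / 2]).
    split=> /=.
      by exists (ball v (r / 2), ball w (r / 2)) => //; split; exact: nbhsx_ballx.
    exact: nbhs_right_le.
  move=> [[v' w'] t] /= [[[_ vv'] [_ ww']] tr] [/= Av' Aw'] x' y' x'c y'c x't y't.
  have cv : close (r / 2) (tup v) (tup v').
    by move=> j; rewrite !tnth_mktuple; exact/ltW/vv'.
  have cw : close (r / 2) (tup w) (tup w').
    by move=> j; rewrite !tnth_mktuple; exact/ltW/ww'.
  have r2 : r / 2 <= r by rewrite ler_pdivrMr// ler_pMr// ler1n.
  have rr : r / 2 + t <= r by lra.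
  rewrite -(subrKA (K (tup v) (tup w))) (splitr e) (le_trans (ler_normD _ _))// lerD//.
    rewrite distrC; apply: rK; [exact: tupc|exact: tupc| |].
      exact: le_close cv.
    exact: le_close cw.
  by apply: rK => //; apply: le_close rr _; exact: close_trans.
move=> H; near (0:R)^'+ => r.
have r0 : 0 < r by near: r; exact: nbhs_right_gt.
exists r => // x y x' y' xc yc x'c y'c xx' yy'.
have Ar z : unit_cube s z -> A (\row_j tnth z j) by move=> zc i; rewrite mxE; exact: zc.
have /(_ (\row_j tnth x j, \row_j tnth y j)) : A `*` A `<=` P r by near: r.
move=> /(_ (conj (Ar _ xc) (Ar _ yc))); rewrite /P/= !tupK; exact.
Unshelve. all: by end_near. Qed.

End uniform_continuity.

(** * Reproducing kernel Hilbert spaces *)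

Section rkhs.
Context {R : realType} (T : Type) (D : set T) (H : completeNormedModType R)
  (ip : {dot H for idfun}) (ev : {linear H -> (T -> R)}) (K : T -> T -> R)
  (hH : is_rkhs D ip ev K).

Lemma ipC f g : ip f g = ip g f.
Proof. by rewrite hermC expr0 mul1r. Qed.

Lemma ip_sumr (I : Type) (r : seq I) (P : pred I) (c : I -> R) (g : I -> H) f :
  ip f (\sum_(i <- r | P i) c i *: g i) = \sum_(i <- r | P i) c i * ip f (g i).
Proof. by rewrite linear_sumr; apply: eq_bigr => i _; rewrite linearZr. Qed.

Lemma ipBB f g : ip (f - g) (f - g) = ip f f - ip f g *+ 2 + ip g g.
Proof. by rewrite linearBl !linearBr/= (ipC g f); ring. Qed.

(** The squared norm of [|g| *: f - |f| *: g] equals [2 * |f| * |g| * (|f| * |g| - ip f g)]. *)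
Lemma CauchySchwarz f g : ip f g <= `|f| * `|g|.
Proof.
have n0 h : ip h h = `|h| ^+ 2 := rkhs_norm hH h.
have [->|f0] := eqVneq f 0; first by rewrite linear0l normr0 mul0r.
have [->|g0] := eqVneq g 0; first by rewrite linear0r normr0 mulr0.
have fg0 : 0 < `|f| * `|g| by rewrite mulr_gt0 ?normr_gt0.
have : 0 <= ip (`|g| *: f - `|f| *: g) (`|g| *: f - `|f| *: g) by rewrite n0 exprn_ge0.
rewrite ipBB !linearZl_LR !linearZr/= !n0 => h.
have : 0 <= (`|f| * `|g|) * (`|f| * `|g| - ip f g) *+ 2.
  apply: le_trans h _; rewrite le_eqVlt; apply/orP; left; apply/eqP.
  by rewrite /GRing.scale/=; ring.
by rewrite pmulrn_lge0// pmulr_rge0// subr_ge0.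
Qed.

Lemma rkhs_representer : exists k : T -> H, forall x, D x ->
  (forall y, D y -> ev (k x) y = K y x) /\ forall f, ev f x = ip f (k x).
Proof.
have /choice[k kP] : forall x, exists k : H, D x ->
    (forall y, D y -> ev k y = K y x) /\ forall f, ev f x = ip f k.
  move=> x; have [Dx|Dx] := pselect (D x); last by exists 0.
  by have [k kx kf] := rkhs_kernel hH Dx; exists k => _; split.
by exists k => x Dx; exact: kP.
Qed.

Context (k : T -> H) (kP : forall x, D x ->
  (forall y, D y -> ev (k x) y = K y x) /\ forall f, ev f x = ip f (k x)).

Lemma ip_repr x y : D x -> D y -> ip (k x) (k y) = K x y.
Proof. by move=> Dx Dy; rewrite ipC -(kP Dx).2 (kP Dy).1. Qed.

(** The squared distance of the representers is [K x x - 2 * K x y + K y y], at most [2 * e]. This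
    makes the unit ball of [H] equicontinuous. *)
Lemma ev_unif (e : R) x y f : 0 <= e -> D x -> D y ->
  `|K x x - K x y| <= e -> `|K y y - K y x| <= e ->
  `|ev f x - ev f y| <= `|f| * Num.sqrt (e *+ 2).
Proof.
move=> e0 Dx Dy xy yx.
have kxy : `|k x - k y| <= Num.sqrt (e *+ 2).
  rewrite -(@ler_pXn2r _ 2) ?nnegrE ?sqrtr_ge0// sqr_sqrtr ?mulrn_wge0//.
  rewrite -(rkhs_norm hH) ipBB !ip_repr//.
  have Kxy : K x y = K y x by rewrite -!ip_repr// ipC.
  move: xy yx; rewrite !ler_norml => /andP[_ h1] /andP[_ h2].
  by rewrite -Kxy in h2; lra.
have main a c : D a -> D c -> `|k a - k c| <= Num.sqrt (e *+ 2) ->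
    ev f a - ev f c <= `|f| * Num.sqrt (e *+ 2).
  move=> Da Dc ac; rewrite (kP Da).2 (kP Dc).2 -linearBr.
  by rewrite (le_trans (CauchySchwarz _ _))// ler_wpM2l.
by rewrite ler_norml lerNl opprB !main// distrC.
Qed.

Lemma norm_sum_repr (I : finType) (c : I -> R) (x : I -> T) : (forall i, D (x i)) ->
  `|\sum_i c i *: k (x i)| ^+ 2 = \sum_i \sum_j c i * c j * K (x i) (x j).
Proof.
move=> Dx; rewrite -(rkhs_norm hH) ip_sumr; under eq_bigr do rewrite ipC ip_sumr mulr_sumr.
by apply: eq_bigr => i _; apply: eq_bigr => j _; rewrite ip_repr// mulrA.
Qed.

End rkhs.

(** By Cauchy-Schwarz the functional [ip _ xi] has norm [|xi|], attained at the normalised [xi];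
    replacing it by [F] costs at most [e] on the unit ball. With bounds in the extended reals,
    finiteness of the supremum is a consequence. *)
Lemma sup_unit_ball_near (R : realType) (H : completeNormedModType R)
    (ip : {dot H for idfun}) (F : H -> R) (xi : H) (e : R) :
  (forall f : H, ip f f = `|f| ^+ 2) -> (forall f g : H, ip f g <= `|f| * `|g|) ->
  0 <= e -> (forall f, `|F f - ip f xi| <= e * `|f|) ->
  (((`|xi| - e)%:E <= ereal_sup [set `|F f|%:E | f in [set f : H | (`|f| <= 1)%R]]) /\
   (ereal_sup [set `|F f|%:E | f in [set f : H | (`|f| <= 1)%R]] <= (`|xi| + e)%:E))%E.
Proof.
move=> n2 cs e0 Fxi.
have ipN f g : ip (- f) g = - ip f g by rewrite linearNl.
split; last first.
  apply: ge_ereal_sup => _ [f /= f1 <-]; rewrite lee_fin.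
  rewrite -(subrK (ip f xi) (F f)) addrC (le_trans (ler_normD _ _))//.
  apply: lerD; last first.
    by rewrite (le_trans (Fxi f))// ler_piMr.
  have fx : `|f| * `|xi| <= `|xi| by rewrite ler_piMl.
  rewrite ler_norml (le_trans (cs f xi) fx) andbT lerNl -ipN.
  by rewrite (le_trans (cs _ _))// normrN.
have [->|xi0] := eqVneq xi 0.
  rewrite normr0 sub0r; apply: (@le_trans _ _ `|F 0|%:E).
    by rewrite lee_fin (@le_trans _ _ 0)// oppr_le0.
  by apply: ereal_sup_ubound; exists 0 => //=; rewrite normr0 ler01.
have nxi : `|xi| != 0 by rewrite normr_eq0.
pose f := `|xi|^-1 *: xi.
have f1 : `|f| = 1 by rewrite normrZ normfV normr_id mulVf.
have fx : ip f xi = `|xi| by rewrite linearZl_LR/= n2 expr2 mulKf.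
apply: (@le_trans _ _ `|F f|%:E); last first.
  by apply: ereal_sup_ubound; exists f => //=; rewrite f1.
rewrite lee_fin; have := Fxi f; rewrite f1 mulr1 fx ler_norml => /andP[h _].
by rewrite (le_trans _ (ler_norm _))//; lra.
Qed.

(** * Absolutely summable families *)

Lemma normc_ge0 (R : realType) (x : R[i]) : 0 <= Normc.normc x.
Proof. by case: x => u v; exact: sqrtr_ge0. Qed.

Lemma ler_normcD (R : realType) (x y : R[i]) :
  Normc.normc (x + y) <= Normc.normc x + Normc.normc y.
Proof. exact: le_normcD. Qed.

Lemma normc_sum (R : realType) (I : Type) (r : seq I) (P : pred I) (a : I -> R[i]) :
  Normc.normc (\sum_(i <- r | P i) a i) <= \sum_(i <- r | P i) Normc.normc (a i).
Proof.
elim/big_ind2: _ => [|x y z t xy zt|//]; first by rewrite Normc.normc0.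
by rewrite (le_trans (ler_normcD _ _))// lerD.
Qed.

(** Choose [F] whose partial sum is within [e] of the total; a disjoint [G] adds its own sum without
    exceeding the total. *)
Lemma esum_tail (R : realType) (T : choiceType) (a : T -> R) (e : R) :
  (forall x, 0 <= a x) -> (\esum_(x in [set: T]) (a x)%:E < +oo)%E -> 0 < e ->
  exists2 F, finite_set F & forall G, finite_set G -> F `&` G `<=` set0 ->
    \sum_(x \in G) a x < e.
Proof.
move=> a0 aoo e0.
have afin : (\esum_(x in [set: T]) (a x)%:E)%E \is a fin_num.
  by rewrite ge0_fin_numE// esum_ge0// => x _; rewrite lee_fin.
have [_ [F [Ffin _] <-] eF] := ub_ereal_sup_adherent e0 afin.
exists F => // G Gfin FG.
have : (\sum_(x \in F `|` G) (a x)%:E <= \esum_(x in [set: T]) (a x)%:E)%E.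
  by apply: ereal_sup_ubound; exists (F `|` G) => //; split => //; rewrite finite_setU.
rewrite -/(esum _ _) in eF; move: eF; rewrite -(fineK afin) !fsumEFin//; last first.
  by rewrite finite_setU.
rewrite fsbigU0// -EFinB lte_fin lee_fin => h1 h2.
by rewrite -(ltrD2l (\sum_(x \in F) a x)) (le_lt_trans h2)// -ltrBlDr.
Qed.

(** Absolute summability reduces the net of finite sums to one exhausting sequence. Once [r n]
    contains the significant part [F0] of [A], any larger finite subset of [A] adds only terms
    outside [F0], of total size below [e / 2]. *)
Lemma has_complex_sum_exhaust (R : realType) (T : choiceType) (A : set T)
    (a : T -> R[i]) (S : R[i]) (r : nat -> seq T) :
  (\esum_(x in [set: T]) (Normc.normc (a x))%:E < +oo)%E ->
  (forall n, uniq (r n)) -> (forall n, [set` r n] `<=` A) ->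
  (forall F, fsets A F -> \forall n \near \oo, F `<=` [set` r n]) ->
  (fun n => Normc.normc (\sum_(x <- r n) a x - S)) @ \oo --> (0 : R) ->
  has_complex_sum A a S.
Proof.
move=> aoo ur rA rF rS e e0.
have e20 : 0 < e / 2 by rewrite divr_gt0.
have [F0 F0fin F0P] := esum_tail (fun x => normc_ge0 (a x)) aoo e20.
have FA : fsets A (F0 `&` A).
  by split; [exact: finite_setIl|exact: subIsetr].
near \oo => n.
have Frn : F0 `&` A `<=` [set` r n] by near: n; exact: rF.
exists [set` r n]; first by split => //; exact: finite_seq.
move=> F [Ffin FsubA] rnF.
have -> : F = [set` r n] `|` (F `\` [set` r n]) by rewrite setDUK.
have Gfin : finite_set (F `\` [set` r n]) by exact: finite_setD.
rewrite fsbigU0//; last by move=> x [? []].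
rewrite -fsbig_seq// addrAC (splitr e) (le_lt_trans (ler_normcD _ _))// ltrD//.
  near: n; have /cvgr_lt := rS; apply; exact: e20.
rewrite fsbig_finite// (le_lt_trans (normc_sum _ _ _))// -fsbig_finite//.
apply: F0P => // x [F0x [Fx rx]]; apply: rx; apply: Frn; split => //; exact: FsubA.
Unshelve. all: by end_near. Qed.

(** * Quadrature on cells *)

Section cell_quadrature.
Context {R : realType} (b : nat) (b1 : (1 < b)%N) (s : nat).
Let b0 : (0 < b)%N := ltnW b1.
Local Notation leb := (@lebesgue_tuple R s).
Local Notation leb2 := (@lebesgue_tuple R s \x @lebesgue_tuple R s)%E.
(** This is the number of level-[n] cells, the inverse of the volume of one cell. *)
Local Notation vol n := (((b ^ n) ^ s)%:R : R).

Let vol_gt0 n : 0 < vol n.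
Proof. by rewrite ltr0n !expn_gt0 b0. Qed.

Let card_cell n : #|{: {ffun 'I_s -> 'I_(b ^ n)}}| = ((b ^ n) ^ s)%N.
Proof. by rewrite card_ffun !card_ord. Qed.

Lemma near_level (r : R) : 0 < r -> \forall n \near \oo, b%:R ^- n <= r.
Proof.
move=> r0; have /cvgr_lt /(_ r r0) := @cvg_expVn R b b1.
by apply: filterS => n /ltW.
Qed.

Lemma trivIset_box n : trivIset setT (@box R b s n).
Proof. by move=> a a' _ _ [x [/(box_cellE b1) -> /(box_cellE b1) ->]]. Qed.

Definition box2 n (aa : {ffun 'I_s -> 'I_(b ^ n)} * {ffun 'I_s -> 'I_(b ^ n)}) :=
  @box R b s n aa.1 `*` @box R b s n aa.2.

Lemma measurable_box2 n aa : measurable (@box2 n aa).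
Proof. by apply: measurableX; exact: measurable_box. Qed.

Lemma lebesgue_box2 n aa : leb2 (@box2 n aa) = (vol n ^- 2)%:E.
Proof.
have := @product_measure1E _ _ _ _ R leb leb _ _
  (measurable_box b1 aa.1) (measurable_box b1 aa.2).
move=> ->; transitivity (((vol n)^-1)%:E * ((vol n)^-1)%:E)%E.
  by congr (_ * _)%E; exact: lebesgue_box.
by rewrite -EFinM -expr2 exprVn.
Qed.

Lemma lebesgue_box_ltey n a : (leb (@box R b s n a) < +oo)%E.
Proof.
by have := ltry ((vol n)^-1); congr (_ < _)%E; exact/esym/(lebesgue_box b1 a).
Qed.

Lemma lebesgue_box2_ltey n aa : (leb2 (@box2 n aa) < +oo)%E.
Proof. by have := ltry (vol n ^- 2); congr (_ < _)%E; exact/esym/lebesgue_box2. Qed.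

Lemma trivIset_box2 n : trivIset setT (@box2 n).
Proof.
move=> [a a'] [c c'] _ _ [[x y] [[/= xa ya] [/= xc yc]]].
by rewrite (box_cellE b1 xa) (box_cellE b1 ya) (box_cellE b1 xc) (box_cellE b1 yc).
Qed.

Lemma unit_cube2_box n :
  unit_cube s `*` unit_cube s = \big[setU/set0]_aa @box2 n aa.
Proof.
rewrite -bigcup_seq; apply/seteqP; split => [[x y] [/= xc yc]|[x y] [[a a'] _]].
  exists (mcell b1 n (fun j => rdigit b (tnth x j)),
          mcell b1 n (fun j => rdigit b (tnth y j))).
    exact: mem_index_enum.
  by split; exact: box_cell.
by move=> [/= xa ya]; split => /=; [exact: box_cube xa|exact: box_cube ya].
Qed.

Lemma close_corner n a x : @box R b s n a x -> close (b%:R ^- n) x (corner a).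
Proof. by move=> ax j; exact: corner_near_box ax j. Qed.

Lemma regulated_cube (F : s.-tuple R -> R) :
  (forall e : R, 0 < e -> exists2 r : R, 0 < r &
    forall x y, unit_cube s x -> unit_cube s y -> close r x y -> `|F x - F y| <= e) ->
  @regulated _ (s.-tuple (measurableTypeR R)) R (unit_cube s) F.
Proof.
move=> Fuc e /Fuc[r r0 Fr]; have [n _ /(_ n (leqnn n)) /= nr] := near_level r0.
exists {ffun 'I_s -> 'I_(b ^ n)}, (@box R b s n), (fun a => F (corner a)); split.
- exact: measurable_box.
- exact: trivIset_box.
- by rewrite (unit_cube_box b1 s n).
- move=> a x xc ax; apply: Fr => //; first exact: corner_cube.
  exact/(le_close nr)/close_corner.
Qed.

Lemma regulated_cube2 (K : s.-tuple R -> s.-tuple R -> R) :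
  (forall e : R, 0 < e -> exists2 r : R, 0 < r &
    forall x y x' y', unit_cube s x -> unit_cube s y -> unit_cube s x' ->
      unit_cube s y' -> close r x x' -> close r y y' -> `|K x y - K x' y'| <= e) ->
  @regulated _ (s.-tuple (measurableTypeR R) * s.-tuple (measurableTypeR R))%type R
    (unit_cube s `*` unit_cube s) (fun p => K p.1 p.2).
Proof.
move=> Kuc e /Kuc[r r0 Kr]; have [n _ /(_ n (leqnn n)) /= nr] := near_level r0.
exists ({ffun 'I_s -> 'I_(b ^ n)} * {ffun 'I_s -> 'I_(b ^ n)})%type, (@box2 n),
  (fun aa => K (corner aa.1) (corner aa.2)); split.
- exact: measurable_box2.
- exact: trivIset_box2.
- by rewrite (unit_cube2_box n).
- move=> [a a'] [x y] [/= xc yc] [/= xa ya].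
  apply: Kr => //; try exact: corner_cube.
  + exact/(le_close nr)/close_corner.
  + exact/(le_close nr)/close_corner.
Qed.

Context (I : finType) (I0 : (0 < #|I|)%N) (z : I -> 'I_s -> nat -> 'Z_b).
Local Notation N := (#|I|%:R : R).

Let N0 : N != 0. Proof. by rewrite pnatr_eq0 -lt0n. Qed.

Definition pcell n p := mcell b1 n (fun j i => z p j i : nat).

(* The signed measure "empirical measure of the points minus Lebesgue measure"
   of the cell [a]. *)
Definition lam n (a : {ffun 'I_s -> 'I_(b ^ n)}) : R :=
  N^-1 * \sum_p (pcell n p == a)%:R - (vol n)^-1.

(** The morphism [f] allows both real test functions, with [idfun], and complex characters, with
    [real_complex]. *)
Lemma sum_lam (A : comNzRingType) (f : {rmorphism R -> A}) n
    (g : {ffun 'I_s -> 'I_(b ^ n)} -> A) :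
  \sum_a f (lam a) * g a = f N^-1 * \sum_p g (pcell n p) - f (vol n)^-1 * \sum_a g a.
Proof.
rewrite /lam; under eq_bigr do rewrite rmorphB rmorphM rmorph_sum mulrBl.
rewrite sumrB -mulr_sumr; congr (_ - _).
under eq_bigr do rewrite -mulrA mulr_suml.
rewrite -mulr_sumr exchange_big/=; congr (_ * _); apply: eq_bigr => p _.
rewrite (bigD1 (pcell n p))//= eqxx rmorph1 mul1r big1 ?addr0// => a.
by rewrite eq_sym => /negbTE ->; rewrite rmorph0 mul0r.
Qed.

(** The empirical and the Lebesgue measure each have mass one. The bound is independent of [n], so
    small errors in the kernel stay small after summation against [lam]. *)
Lemma sum_norm_lam n : \sum_(a : {ffun 'I_s -> 'I_(b ^ n)}) `|lam a| <= 2.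
Proof.
pose g (a : {ffun 'I_s -> 'I_(b ^ n)}) : R :=
  N^-1 * (\sum_p (pcell n p == a)%:R) + (vol n)^-1.
apply: (@le_trans _ _ (\sum_a g a)).
  apply: ler_sum => a _; rewrite /lam (le_trans (ler_normB _ _))// /g lerD//.
    by rewrite ger0_norm// mulr_ge0 ?invr_ge0// sumr_ge0.
  by rewrite ger0_norm// invr_ge0 ltW.
have V1 : \sum_(a : {ffun 'I_s -> 'I_(b ^ n)}) (vol n)^-1 = 1.
  by rewrite sumr_const card_cell -[LHS]mulr_natr mulVf// gt_eqF.
rewrite /g big_split/= V1 -mulr_sumr exchange_big/=.
rewrite (eq_bigr (fun=> 1)) ?sumr_const ?mulVf//.
move=> p _; rewrite (bigD1 (pcell n p))//= eqxx big1 ?addr0// => a.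
by rewrite eq_sym => /negbTE ->.
Qed.

(** One error [e] comes from moving each sample point to the corner of its cell, the other from
    replacing [F] by its corner value on each box. *)
Lemma mean_sub_integral_near (F : s.-tuple R -> R) n (e : R) : 0 <= e ->
  leb.-integrable (unit_cube s) (EFin \o F) ->
  (forall x y, unit_cube s x -> unit_cube s y -> close (b%:R ^- n) x y ->
    `|F x - F y| <= e) ->
  `|(sample_mean (fun p => badic_mproj (z p)) F - cube_integral F) -
    \sum_(a : {ffun 'I_s -> 'I_(b ^ n)}) lam a * F (corner a)| <= e *+ 2.
Proof.
move=> e0 iF Fe; rewrite (@sum_lam R idfun)/= opprB addrACA mulr2n.
have mF a : leb.-integrable (@box R b s n a) (EFin \o F).
  apply: integrableS iF; [|exact: measurable_box|exact: box_cube].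
  by rewrite (unit_cube_box b1 s n); apply: bigsetU_measurable => c _; exact: measurable_box.
rewrite [X in `|X|](_ : _ =
  N^-1 * (\sum_p (F (badic_mproj (z p)) - F (corner (pcell n p)))) -
  \sum_(a : {ffun 'I_s -> 'I_(b ^ n)})
    (\int[leb]_(x in @box R b s n a) F x - F (corner a) * (vol n)^-1)); last first.
  rewrite /sample_mean /cube_integral (unit_cube_box b1 s n) Rintegral_partition//.
  - by rewrite !sumrB -mulr_suml; ring.
  - exact: measurable_box.
  - exact: trivIset_box.
rewrite (le_trans (ler_normB _ _))// lerD//.
  rewrite normrM ger0_norm ?invr_ge0// -(@ler_pM2l _ N) ?ltr0n// mulVKf//.
  rewrite (le_trans (ler_norm_sum _ _ _))// mulr_natl -sumr_const ler_sum// => p _.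
  apply: Fe; [exact: badic_mproj_cube|exact: corner_cube|].
  by move=> j; exact: (corner_near_proj b1).
rewrite (le_trans (ler_norm_sum _ _ _))//.
rewrite (le_trans (_ : _ <= \sum_(a : {ffun 'I_s -> 'I_(b ^ n)}) e * (vol n)^-1))//.
  apply: ler_sum => a _; have E : (vol n)^-1 = fine (leb (@box R b s n a)).
    exact/esym/(congr1 fine (lebesgue_box b1 a)).
  rewrite E; apply: Rintegral_near_cst => //; first exact: measurable_box.
    exact: lebesgue_box_ltey.
  move=> x ax; apply: Fe; [exact: box_cube ax|exact: corner_cube|exact: close_corner].
by rewrite sumr_const card_cell -[X in X <= _]mulr_natr -mulrA mulVf ?mulr1// gt_eqF.
Qed.

Context (K : s.-tuple R -> s.-tuple R -> R)
  (iK : leb2.-integrable (unit_cube s `*` unit_cube s) (EFin \o (fun p => K p.1 p.2))).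

Let iKbox n aa : leb2.-integrable (@box2 n aa) (EFin \o (fun p => K p.1 p.2)).
Proof.
apply: integrableS iK; [|exact: measurable_box2|].
  rewrite (unit_cube2_box n); apply: bigsetU_measurable => c _; exact: measurable_box2.
by move=> [x y] [/= xa ya]; split => /=; [exact: box_cube xa|exact: box_cube ya].
Qed.

(** An index below [b ^ n] sees only the first [n] digits of [x], and these determine the box. *)
Lemma mwal_box n (k a : {ffun 'I_s -> 'I_(b ^ n)}) x :
  @box R b s n a x -> mwal b (tuple_of_cell k) x = mchi k a :> R[i].
Proof.
move=> ax; rewrite (box_cellE b1 ax) mchi_cell expr_sum; apply: eq_bigr => j _.
rewrite /wal tnth_tuple_of_cell; congr (_ ^+ _).
by rewrite (@sum_digit_trunc nat (fun i d => d * rdigit b (tnth x j) i)%N b (k j) n).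
Qed.

Lemma walsh_coef_box n (k l : {ffun 'I_s -> 'I_(b ^ n)}) :
  walsh_coef b K (tuple_of_cell k) (tuple_of_cell l) =
  \sum_aa (\int[leb2]_(p in @box2 n aa) K p.1 p.2)%:C%C *
    ((mchi k aa.1)^*%C * mchi l aa.2).
Proof.
rewrite /walsh_coef (unit_cube2_box n).
apply: (@complex_integral_partition _ _ _ leb2 _ (@box2 n) (fun p => K p.1 p.2)) => //.
- exact: measurable_box2.
- exact: trivIset_box2.
- by move=> [a a'] [x y] [/= xa ya]; rewrite (mwal_box _ xa) (mwal_box _ ya) mulrA.
Qed.

(** A Parseval identity: [c] is the transform of [lam], and orthogonality inverts it up to the
    factor [vol n], once in each variable. *)
Lemma sum_walsh_coef_lam n (c : {ffun 'I_s -> 'I_(b ^ n)} -> R[i]) :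
  (forall k, c k = \sum_a (lam a)%:C%C * mchi k a) ->
  \sum_k \sum_l c k * (c l)^*%C *
     walsh_coef b K (tuple_of_cell k) (tuple_of_cell l) =
  (vol n ^+ 2 * \sum_a \sum_a' lam a * lam a' *
    \int[leb2]_(p in @box2 n (a, a')) K p.1 p.2)%:C%C.
Proof.
move=> cE.
pose J a a' := (\int[leb2]_(p in @box2 n (a, a')) K p.1 p.2)%:C%C.
have S1 a : \sum_k c k * (mchi k a)^*%C = (lam a * vol n)%:C%C.
  under eq_bigr do rewrite cE mulr_suml.
  rewrite exchange_big/= (bigD1 a)//= [X in _ + X]big1 => [|e ea].
    rewrite addr0; under eq_bigr do rewrite -mulrA (mulrC (mchi _ _)).
    by rewrite -mulr_sumr sum_mchi_orth// eqxx rmorphM/= rmorph_nat.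
  under eq_bigr do rewrite -mulrA (mulrC (mchi _ _)).
  by rewrite -mulr_sumr sum_mchi_orth// eq_sym (negbTE ea) mulr0.
have conjE l : (c l)^*%C = \sum_a (lam a)%:C%C * (mchi l a)^*%C.
  rewrite cE (rmorph_sum (@conjc R))/=; apply: eq_bigr => a _.
  by case: (mchi l a) => u v; simpc.
have S2 a : \sum_l (c l)^*%C * mchi l a = (lam a * vol n)%:C%C.
  under eq_bigr do rewrite conjE mulr_suml.
  rewrite exchange_big/= (bigD1 a)//= [X in _ + X]big1 => [|e ea].
    rewrite addr0; under eq_bigr do rewrite -mulrA.
    by rewrite -mulr_sumr sum_mchi_orth// eqxx rmorphM/= rmorph_nat.
  under eq_bigr do rewrite -mulrA.
  by rewrite -mulr_sumr sum_mchi_orth// (negbTE ea) mulr0.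
transitivity (\sum_a \sum_a' J a a' *
    ((\sum_k c k * (mchi k a)^*%C) * (\sum_l (c l)^*%C * mchi l a'))).
  under [RHS]eq_bigr do under eq_bigr do rewrite big_distrlr mulr_sumr.
  under [RHS]eq_bigr do rewrite exchange_big.
  rewrite [RHS]exchange_big; apply: eq_bigr => k _ /=.
  under [RHS]eq_bigr do under eq_bigr do rewrite mulr_sumr.
  under [RHS]eq_bigr do rewrite exchange_big.
  rewrite [RHS]exchange_big; apply: eq_bigr => l _ /=.
  rewrite walsh_coef_box pair_bigA mulr_sumr; apply: eq_bigr => -[a a'] _ /=.
  by rewrite /J; ring.
rewrite rmorphM rmorph_sum mulr_sumr; apply: eq_bigr => a _.
rewrite rmorph_sum mulr_sumr; apply: eq_bigr => a' _.
by rewrite S1 S2 /J -!rmorphM/=; congr (_%:C)%C; ring.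
Qed.

Lemma box_average_near n (e : R) : 0 <= e ->
  (forall x y x' y', unit_cube s x -> unit_cube s y -> unit_cube s x' ->
      unit_cube s y' -> close (b%:R ^- n) x x' -> close (b%:R ^- n) y y' ->
      `|K x y - K x' y'| <= e) ->
  `|vol n ^+ 2 * (\sum_(a : {ffun 'I_s -> 'I_(b ^ n)}) \sum_a' lam a * lam a' *
      \int[leb2]_(p in @box2 n (a, a')) K p.1 p.2) -
    \sum_(a : {ffun 'I_s -> 'I_(b ^ n)}) \sum_(a' : {ffun 'I_s -> 'I_(b ^ n)})
      lam a * lam a' * K (corner a) (corner a')| <= e *+ 4.
Proof.
move=> e0 Ke; have vn0 : vol n != 0 by rewrite gt_eqF.
have near a a' :
    `|vol n ^+ 2 * (\int[leb2]_(p in @box2 n (a, a')) K p.1 p.2) -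
      K (corner a) (corner a')| <= e.
  have v2 : 0 < vol n ^- 2 by rewrite invr_gt0 exprn_gt0.
  (* Multiplying by the volume of the product box turns the average into an integral. *)
  rewrite -(ler_pM2r v2) -{1}(gtr0_norm v2) -normrM mulrBl mulrAC mulfV ?expf_neq0// mul1r.
  have E : vol n ^- 2 = fine (leb2 (@box2 n (a, a'))).
    exact/esym/(congr1 fine (lebesgue_box2 (a, a'))).
  rewrite E; apply: (@Rintegral_near_cst _ _ _ leb2 _ (fun p => K p.1 p.2)) => //.
  - exact: measurable_box2.
  - exact: lebesgue_box2_ltey.
  - move=> [x y] [/= xa ya]; apply: Ke; try exact: corner_cube; try exact: close_corner.
    + exact: box_cube xa.
    + exact: box_cube ya.
rewrite mulr_sumr -sumrB (le_trans (ler_norm_sum _ _ _))//.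
apply: (@le_trans _ _ (\sum_(a : {ffun 'I_s -> 'I_(b ^ n)})
    \sum_(a' : {ffun 'I_s -> 'I_(b ^ n)}) `|lam a| * `|lam a'| * e)).
  apply: ler_sum => a _; rewrite mulr_sumr -sumrB (le_trans (ler_norm_sum _ _ _))//.
  by apply: ler_sum => a' _; rewrite mulrCA -mulrBr !normrM ler_wpM2l// mulr_ge0.
have -> : \sum_(a : {ffun 'I_s -> 'I_(b ^ n)})
    \sum_(a' : {ffun 'I_s -> 'I_(b ^ n)}) `|lam a| * `|lam a'| * e =
    (\sum_(a : {ffun 'I_s -> 'I_(b ^ n)}) `|lam a|) ^+ 2 * e.
  by rewrite expr2 big_distrlr mulr_suml; apply: eq_bigr => a _; rewrite mulr_suml.
rewrite -mulr_natl ler_wpM2r//.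
have := sum_norm_lam n; have : 0 <= \sum_(a : {ffun 'I_s -> 'I_(b ^ n)}) `|lam a|.
  by rewrite sumr_ge0.
by move=> h1 h2; nra.
Qed.

End cell_quadrature.

(** * The worst-case error *)

Lemma tuple_of_cell_inj b s n : injective (@tuple_of_cell b s n).
Proof.
move=> k l kl; apply/ffunP => j; apply/val_inj => /=.
by rewrite -!(tnth_tuple_of_cell _ j) kl.
Qed.

Lemma tuple_of_cell_surj b s n (t : s.-tuple nat) :
  (forall j, (tnth t j < b ^ n)%N) -> exists k, @tuple_of_cell b s n k = t.
Proof.
move=> tn; exists [ffun j => Ordinal (tn j)].
by apply: eq_from_tnth => j; rewrite tnth_mktuple ffunE.
Qed.

Lemma tuple_of_cell_eq0 b s n (k : {ffun 'I_s -> 'I_(b ^ n)}) :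
  (tuple_of_cell k == [tuple of nseq s 0%N]) = [forall j, k j == 0%N :> nat].
Proof.
apply/eqP/forallP => [k0 j|k0].
  by rewrite -(tnth_tuple_of_cell k) k0 tnth_nseq.
by apply: eq_from_tnth => j; rewrite tnth_tuple_of_cell tnth_nseq; exact/eqP.
Qed.

Definition antithetic_dual b m s (C : 'I_s -> nat -> 'rV['Z_b]_m) : set (s.-tuple nat) :=
  [set k | [/\ dual_net C k, k <> [tuple of nseq s 0%N] & mdigit_sum b k = 0%N]].

(** The sample mean of a character is the indicator of dual indices with zero digit sum; its average
    over all cells is the indicator of the zero index, and subtracting it removes exactly that
    index. *)
Lemma sum_lam_mchi (R : realType) b (b1 : (1 < b)%N) m s
    (C : 'I_s -> nat -> 'rV['Z_b]_m) n (k : {ffun 'I_s -> 'I_(b ^ n)}) :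
  \sum_a (lam b1 (antithetic (digital_net C)) a)%:C%C * mchi k a =
  `[< antithetic_dual C (tuple_of_cell k) >]%:R :> R[i].
Proof.
have b0 : (0 < b)%N := ltnW b1.
have cI : #|{: 'Z_b * 'I_(b ^ m)}| = (b * b ^ m)%N.
  by rewrite card_prod !card_ord Zp_cast.
have I0 : (0 < #|{: 'Z_b * 'I_(b ^ m)}|)%N by rewrite cI muln_gt0 b0 expn_gt0 b0.
rewrite (sum_lam b1 _ (real_complex R)) sum_mchi_antithetic sum_mchi// cI.
rewrite -tuple_of_cell_eq0 !fmorphV !rmorph_nat.
have N0 : (b * b ^ m)%:R != 0 :> R[i] by rewrite pnatr_eq0 -lt0n -cI.
have V0 : ((b ^ n) ^ s)%:R != 0 :> R[i] by rewrite pnatr_eq0 -lt0n !expn_gt0 b0.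
case: eqP => [k0|k0].
  have kj j : k j = 0%N :> nat by rewrite -(tnth_tuple_of_cell k) k0 tnth_nseq.
  rewrite asboolT; last first.
    split; first apply/dual_netE => // c.
      by rewrite big1// => j _; rewrite big1// => i _; rewrite kj digit0 mul0r.
    apply/eqP; rewrite mdigit_sum_eq0// big1// => j _; rewrite big1// => i _.
    by rewrite kj digit0.
  by rewrite !mulVf// subrr asboolF// => -[].
rewrite mulr0 subr0; case: asboolP => [[dk sk]|h].
  by rewrite mulVf// asboolT.
by rewrite mulr0 asboolF// => -[dk _ sk]; apply: h.
Qed.

(** At level [0] there is a single cell, so the cube inherits measurability and finite measure from
    the boxes. *)
Lemma unit_cube_level0 {R : realType} b (b1 : (1 < b)%N) s
    (a : {ffun 'I_s -> 'I_(b ^ 0)}) : unit_cube s = @box R b s 0 a.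
Proof.
apply/seteqP; split => [x xc|]; last exact: box_cube.
rewrite (_ : a = mcell b1 0 (fun j => rdigit b (tnth x j))); first exact: box_cell.
by apply/ffunP => j; apply/val_inj; move: (a j) (mcell _ _ _ j) => [[|u] +] [[|v] +].
Qed.

Section worst_case_error.
Context {R : realType} (b m s : nat) (b1 : (1 < b)%N)
  (C : 'I_s -> nat -> 'rV['Z_b]_m) (H : completeNormedModType R)
  (ip : {dot H for idfun}) (ev : {linear H -> (s.-tuple R -> R)})
  (K : s.-tuple R -> s.-tuple R -> R) (hH : is_rkhs (unit_cube s) ip ev K).
Context (Kc : {within unit_cube s `*` unit_cube s, continuous (fun p => K p.1 p.2)}).
Local Notation leb := (@lebesgue_tuple R s).
Local Notation leb2 := (@lebesgue_tuple R s \x @lebesgue_tuple R s)%E.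
Local Notation P := (antithetic (digital_net C)).
Let b0 : (0 < b)%N := ltnW b1.
Let Kuc := unit_cube2_unif_continuous Kc.

Let I0 : (0 < #|{: 'Z_b * 'I_(b ^ m)}|)%N.
Proof. by rewrite card_prod !card_ord Zp_cast// muln_gt0 b0 expn_gt0 b0. Qed.

Let a0 : {ffun 'I_s -> 'I_(b ^ 0)} := [ffun=> Ordinal (isT : (0 < b ^ 0)%N)].

Lemma integrable_kernel :
  leb2.-integrable (unit_cube s `*` unit_cube s) (EFin \o (fun p => K p.1 p.2)).
Proof.
have cb : unit_cube s `*` unit_cube s = @box2 R b s 0 (a0, a0).
  by rewrite /box2 -(unit_cube_level0 b1).
apply: regulated_integrable; last exact: (regulated_cube2 b1).
  by rewrite cb; exact: measurable_box2.
by rewrite cb; exact: lebesgue_box2_ltey.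
Qed.

Lemma near_kernel (e : R) : 0 < e -> \forall n \near \oo,
  forall x y x' y', unit_cube s x -> unit_cube s y -> unit_cube s x' ->
    unit_cube s y' -> close (b%:R ^- n) x x' -> close (b%:R ^- n) y y' ->
    `|K x y - K x' y'| <= e.
Proof.
move=> /Kuc[r r0 Kr]; apply: filterS (near_level b1 r0) => n nr x y x' y' *.
by apply: Kr => //; exact: le_close nr _.
Qed.

Context (k : s.-tuple R -> H) (kP : forall x, unit_cube s x ->
  (forall y, unit_cube s y -> ev (k x) y = K y x) /\ forall f, ev f x = ip f (k x)).

Lemma near_ev (e : R) : 0 < e -> \forall n \near \oo,
  forall f x y, unit_cube s x -> unit_cube s y -> close (b%:R ^- n) x y ->
    `|ev f x - ev f y| <= `|f| * e.
Proof.
(* [ev_unif] takes the square root of twice the kernel error, so [e ^+ 2 / 2] yields [e]. *)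
move=> e0; have e20 : 0 < e ^+ 2 / 2 by rewrite divr_gt0 ?exprn_gt0.
apply: filterS (near_kernel e20) => n Kn f x y xc yc xy.
have n0 : 0 <= b%:R ^- n :> R by rewrite invr_ge0 exprn_ge0.
have <- : Num.sqrt (e ^+ 2 / 2 *+ 2) = e.
  by rewrite -mulr_natr divfK ?pnatr_eq0// sqrtr_sqr gtr0_norm.
apply: (ev_unif hH kP) => //; first exact: ltW.
  by apply: Kn => //; exact: close_refl.
by apply: Kn => //; [exact: close_refl|exact: closeC].
Qed.

Lemma integrable_ev f : leb.-integrable (unit_cube s) (EFin \o ev f).
Proof.
apply: regulated_integrable.
- by rewrite (unit_cube_level0 b1 a0); exact: measurable_box.
- by rewrite (unit_cube_level0 b1 a0); exact: lebesgue_box_ltey.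
apply: (regulated_cube b1) => e e0.
(* Adding [1] keeps the denominator positive when [f] is zero. *)
have ef0 : 0 < e / (`|f| + 1) by rewrite divr_gt0// ltr_wpDl.
have [n _ /(_ n (leqnn n)) /= fn] := near_ev ef0.
exists (b%:R ^- n); first by rewrite invr_gt0 exprn_gt0// ltr0n.
move=> x y xc yc xy; apply: (le_trans (fn f x y xc yc xy)).
by rewrite mulrCA ler_piMr ?(ltW e0)// ler_pdivrMr ?ltr_wpDl// mul1r lerDl.
Qed.

(** This represents the functional sending [f] to the [lam]-weighted sum of its corner values. *)
Definition discrepancy n : H :=
  \sum_(a : {ffun 'I_s -> 'I_(b ^ n)}) lam b1 P a *: k (corner a).

Lemma near_worst_case_error (e : R) : 0 < e -> \forall n \near \oo,
  ((`|discrepancy n| - e)%:E <= worst_case_error ev (fun p => badic_mproj (P p)))%E /\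
  (worst_case_error ev (fun p => badic_mproj (P p)) <= (`|discrepancy n| + e)%:E)%E.
Proof.
move=> e0; have e20 : 0 < e / 2 by rewrite divr_gt0.
apply: filterS (near_ev e20) => n evn.
apply: (sup_unit_ball_near (rkhs_norm hH) (CauchySchwarz hH) (ltW e0)) => f.
rewrite /discrepancy ip_sumr.
under [X in _ - X]eq_bigr do rewrite -(kP (corner_cube b1 _)).2.
have -> : e * `|f| = (`|f| * (e / 2)) *+ 2 by rewrite -mulr_natr; field.
apply: mean_sub_integral_near => //.
- by rewrite mulr_ge0// ltW.
- exact: integrable_ev.
- by move=> x y xc yc xy; exact: evn.
Qed.

(** This is the sum of the Walsh coefficients over the admissible pairs of indices below [b ^ n],
    rewritten on cells by [sum_walsh_coef_lam]. *)
Definition box_form n : R := ((b ^ n) ^ s)%:R ^+ 2 *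
  \sum_(a : {ffun 'I_s -> 'I_(b ^ n)}) \sum_(a' : {ffun 'I_s -> 'I_(b ^ n)})
    lam b1 P a * lam b1 P a' * \int[leb2]_(p in @box2 R b s n (a, a')) K p.1 p.2.

Lemma near_box_form (e : R) : 0 < e -> \forall n \near \oo,
  `|box_form n - `|discrepancy n| ^+ 2| <= e.
Proof.
move=> e0; have e40 : 0 < e / 4 by rewrite divr_gt0.
apply: filterS (near_kernel e40) => n Kn.
rewrite /discrepancy (norm_sum_repr hH kP); last by move=> a; exact: corner_cube.
have -> : e = (e / 4) *+ 4 by rewrite -mulr_natr divfK.
by apply: (box_average_near b1 I0 _ integrable_kernel) => //; exact: ltW.
Qed.

Lemma worst_case_error_fin_num :
  worst_case_error ev (fun p => badic_mproj (P p)) \is a fin_num.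
Proof.
have [n _ /(_ n (leqnn n)) /= [h1 h2]] := near_worst_case_error ltr01.
by rewrite fin_numE; apply/andP; split; apply/eqP => h; rewrite h in h1 h2.
Qed.

Lemma cvg_box_form :
  box_form n @[n --> \oo] -->
    fine (worst_case_error ev (fun p => badic_mproj (P p))) ^+ 2.
Proof.
set e := fine _.
have ne : `|discrepancy n| @[n --> \oo] --> e.
  apply/cvgrPdist_le => d d0; apply: filterS (near_worst_case_error d0) => n.
  rewrite -(fineK worst_case_error_fin_num) !lee_fin -/e => -[h1 h2].
  by rewrite ler_norml; lra.
have -> : box_form = (fun n => (box_form n - `|discrepancy n| ^+ 2) + `|discrepancy n| ^+ 2).
  by apply/funext => n; rewrite subrK.
rewrite -[e ^+ 2]add0r; apply: cvgD; last by rewrite expr2; exact: cvgM.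
apply/cvgrPdist_le => d d0; apply: filterS (near_box_form d0) => n.
by rewrite sub0r normrN.
Qed.

End worst_case_error.

Theorem theorem2 (R : realType) (b m s : nat)
    (hb : (2 <= b)%N) (hm : (1 <= m)%N) (hs : (1 <= s)%N)
    (C : 'I_s -> nat -> 'rV['Z_b]_m)
    (H : completeNormedModType R) (ip : {dot H for idfun})
    (ev : {linear H -> (s.-tuple R -> R)})
    (K : s.-tuple R -> s.-tuple R -> R)
    (hH : is_rkhs (unit_cube s) ip ev K)
    (hKcont : {within unit_cube s `*` unit_cube s,
                continuous (fun p => K p.1 p.2)})
    (hKdiag : (\int[@lebesgue_tuple R s]_(x in unit_cube s)
                 (Num.sqrt (K x x))%:E < +oo)%E)
    (hKsum : (\esum_(kl in [set: s.-tuple nat * s.-tuple nat])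
                (Normc.normc (walsh_coef b K kl.1 kl.2))%:E < +oo)%E) :
  exists2 e : R,
    worst_case_error ev (fun p => badic_mproj (antithetic (digital_net C) p)) = e%:E &
    has_complex_sum
      [set kl : s.-tuple nat * s.-tuple nat |
        [/\ dual_net C kl.1, kl.1 <> [tuple of nseq s 0%N],
            dual_net C kl.2, kl.2 <> [tuple of nseq s 0%N] &
            mdigit_sum b kl.1 = 0%N /\ mdigit_sum b kl.2 = 0%N]]
      (fun kl => walsh_coef b K kl.1 kl.2)
      (e ^+ 2)%:C%C.
Proof.
have [k kP] := rkhs_representer hH.
have Wfin := worst_case_error_fin_num hb C hH hKcont kP.
exists (fine (worst_case_error ev (fun p => badic_mproj (antithetic (digital_net C) p)))).
  by rewrite fineK.
pose D := antithetic_dual C.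
pose cells n := {ffun 'I_s -> 'I_(b ^ n)}.
pose toP n (kl : cells n * cells n) := (tuple_of_cell kl.1, tuple_of_cell kl.2).
(* [r n] lists the admissible pairs all of whose components are below [b ^ n]. *)
pose r n := [seq toP n kl | kl <- index_enum {: cells n * cells n} &
  `[< D (tuple_of_cell kl.1) >] && `[< D (tuple_of_cell kl.2) >]].
apply: (@has_complex_sum_exhaust _ _ _ _ _ r) => //.
- move=> n; rewrite map_inj_uniq ?filter_uniq ?index_enum_uniq//.
  move=> [k1 l1] [k2 l2] kl; congr (_, _); apply: tuple_of_cell_inj.
    exact: (congr1 fst kl).
  exact: (congr1 snd kl).
- move=> n _ /mapP[[k1 l1] + ->] /=; rewrite mem_filter.
  move=> /andP[/andP[/= /asboolP + /asboolP +] _].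
  by move=> [? ? ?] [? ? ?]; split.
- move=> F [/finite_seqP[X ->] XA].
  (* [M] bounds every component of every pair in [X], so [n >= M] puts them all below [b ^ n]. *)
  pose M := (\max_(x <- X) (\sum_j tnth x.1 j + \sum_j tnth x.2 j))%N.
  exists M => // n /= Mn x xX; have [d1 z1 d2 z2 [s1 s2]] := XA x xX.
  have xM : (\sum_j tnth x.1 j + \sum_j tnth x.2 j <= M)%N.
    exact: (leq_bigmax_seq (F := fun x : s.-tuple nat * s.-tuple nat =>
      \sum_j tnth x.1 j + \sum_j tnth x.2 j)%N x xX).
  have nb : (n < b ^ n)%N by exact: ltn_expl.
  have [k1 k1E] : exists k1, @tuple_of_cell b s n k1 = x.1.
    apply: tuple_of_cell_surj => j; apply: leq_ltn_trans nb.
    by move: xM; rewrite (bigD1 j)//=; lia.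
  have [l1 l1E] : exists l1, @tuple_of_cell b s n l1 = x.2.
    apply: tuple_of_cell_surj => j; apply: leq_ltn_trans nb.
    by move: xM; rewrite addnC (bigD1 j)//=; lia.
  apply/mapP; exists (k1, l1); last by rewrite /toP/= k1E l1E -surjective_pairing.
  rewrite mem_filter mem_index_enum andbT /= k1E l1E.
  by apply/andP; split; apply/asboolP; split.
have bc := cvg_box_form hb (C := C) hH hKcont kP.
(* The transform [c] of [lam] takes only the values [0] and [1], so the weights [c k * (c l)^*]
   select exactly the pairs in [r n]. *)
have sumE n : \sum_(x <- r n) walsh_coef b K x.1 x.2 = (box_form hb C K n)%:C%C.
  pose c (k : cells n) : R[i] := `[< D (tuple_of_cell k) >]%:R.
  rewrite -(@sum_walsh_coef_lam _ _ hb _ _ _ _ (integrable_kernel hb hKcont) n c).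
    rewrite pair_bigA big_map big_filter big_mkcond/=.
    apply: eq_bigr => -[k1 l1] _; rewrite /c conjc_nat/=.
    by do 2 case: asboolP => _ /=; rewrite ?(mul1r, mul0r).
  by move=> k1; rewrite sum_lam_mchi.
under eq_fun do rewrite sumE -rmorphB/= expr0n/= addr0 sqrtr_sqr.
apply/cvgrPdist_le => d d0; move/cvgrPdist_le : bc => /(_ d d0); apply: filterS => n.
by rewrite sub0r normrN normr_id distrC.
Qed.
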